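(* Let $(M,J,g)$ be a conformal Kähler manifold with Norden metric of dimension $2n$, and for $\lambda_1,\dots,\lambda_8\in\mathbb{R}$ let $\nabla'$ be the complex connection $\nabla'_xy=\nabla_xy+Q(x,y)$ with $$\begin{aligned}Q(x,y)={}&\tfrac{1}{2n}\left[\theta(Jy)x-g(x,y)J\Omega\right]+\tfrac1n\big\{\lambda_1\theta(x)y+\lambda_2\theta(x)Jy+\lambda_3\theta(Jx)y+\lambda_4\theta(Jx)Jy\\&+\lambda_5[\theta(y)x-\theta(Jy)Jx]+\lambda_6[\theta(y)Jx+\theta(Jy)x]\\&+\lambda_7[g(x,y)\Omega-g(x,Jy)J\Omega]+\lambda_8[g(x,Jy)\Omega+g(x,y)J\Omega]\big\},\end{aligned}$$ and let $R'$ be its curvature tensor of type $(0,4)$. Then $R'$ is a Kähler curvature-like tensor if and only if $\lambda_7=-\lambda_5$ and $\lambda_8=-\lambda_6$. In this case one obtains a six-parametric family of complex connections $\nabla'$ whose curvature tensors $R'$ have the form $$\begin{aligned}R'={}&R^0+\tfrac{\lambda_7}{n}\{\psi_1-\psi_2\}(S_1)+\tfrac{\lambda_8}{n}\{\psi_1-\psi_2\}(S_2)+\tfrac{\lambda_7(4\lambda_8-1)}{2n^2}\{\psi_1-\psi_2\}(S_3)\\&+\tfrac{\lambda_7(1-2\lambda_8)\theta(J\Omega)}{n^2}\{\pi_1-\pi_2\}+\tfrac{2\lambda_7\lambda_8\theta(\Omega)}{n^2}\pi_3,\end{aligned}$$ where $$\begin{aligned} S_1(x,y)={}&(\nabla_x\theta)y+\tfrac{\lambda_7}{n}[\theta(x)\theta(y)-\theta(Jx)\theta(Jy)]-\tfrac{\lambda_7\theta(\Omega)}{2n}g(x,y)+\tfrac{\lambda_7\theta(J\Omega)}{2n}g(x,Jy),\\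 S_2(x,y)={}&(\nabla_x\theta)Jy+\tfrac{1-2\lambda_8}{2n}[\theta(x)\theta(y)-\theta(Jx)\theta(Jy)]+\tfrac{\lambda_8\theta(\Omega)}{2n}g(x,y)+\tfrac{(1-\lambda_8)\theta(J\Omega)}{2n}g(x,Jy),\\ S_3(x,y)={}&\theta(x)\theta(Jy)+\theta(Jx)\theta(y), \end{aligned}$$ and $R^0=R-\frac{1}{2n}\psi_1(P)$ with $$P(x,y)=(\nabla_x\theta)Jy+\tfrac{1}{2n}\theta(x)\theta(y)+\tfrac{\theta(\Omega)}{4n}g(x,y)+\tfrac{\theta(J\Omega)}{2n}g(x,Jy).$$
   Context: An almost complex manifold with Norden metric $(M,J,g)$ is a smooth $2n$-dimensional manifold with an almost complex structure $J$ ($J^2=-\mathrm{id}$) and a pseudo-Riemannian metric $g$ with $g(Jx,Jy)=-g(x,y)$. Put $\widetilde g(x,y)=g(x,Jy)$. Let $\nabla$ be the Levi-Civita connection of $g$ and $F(x,y,z)=g((\nabla_xJ)y,z)$. The Lie 1-forms are $\theta(x)=g^{ij}F(e_i,e_j,x)$ (for any local basis $\{e_i\}$, $(g^{ij})$ the inverse matrix of $g$) and $\theta^*=\theta\circ J$; the Lie vector $\Omega$ is defined by $\theta(x)=g(x,\Omega)$. $(M,J,g)$ is a $\mathcal{W}_1$-manifold if $$F(x,y,z)=\tfrac{1}{2n}\left[g(x,y)\theta(z)+g(x,Jy)\theta(Jz)+g(x,z)\theta(y)+g(x,Jz)\theta(Jy)\right].$$ A conformal Kähler manifold with Norden metric is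 a $\mathcal{W}_1$-manifold with $d\theta=d\theta^*=0$. A linear connection $D$ is complex if $DJ=0$. Curvature convention: for a connection $D$, its curvature is $R^D(x,y)z=D_xD_yz-D_yD_xz-D_{[x,y]}z$ and $R^D(x,y,z,u)=g(R^D(x,y)z,u)$; $R$ denotes the curvature tensor of $\nabla$. ($R^0$ is the $(0,4)$ curvature tensor of the connection $\nabla^0_xy=\nabla_xy+\frac1{2n}[\theta(Jy)x-g(x,y)J\Omega]$.) A $(0,4)$-tensor $L$ is curvature-like if $L(x,y,z,u)=-L(y,x,z,u)=-L(x,y,u,z)$ and $L(x,y,z,u)+L(y,z,x,u)+L(z,x,y,u)=0$; it is a Kähler (curvature-like) tensor if moreover $L(x,y,Jz,Ju)=-L(x,y,z,u)$. For a $(0,2)$-tensor $S$: $$\psi_1(S)(x,y,z,u)=g(y,z)S(x,u)-g(x,z)S(y,u)+g(x,u)S(y,z)-g(y,u)S(x,z),$$ $$\psi_2(S)(x,y,z,u)=g(y,Jz)S(x,Ju)-g(x,Jz)S(y,Ju)+g(x,Ju)S(y,Jz)-g(y,Ju)S(x,Jz),$$ $\{\psi_1-\psi_2\}(S)=\psi_1(S)-\psi_2(S)$, $\pi_1=\frac12\psi_1(g)$, $\pi_2=\frac12\psi_2(g)$, $\pi_3=-\psi_1(\widetilde g)=\psi_2(\widetilde g)$.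
   Formalization: The ''if and only if'' is read as ''R' is Kähler for all conformal Kähler manifolds of dimension 2n iff ...'' (for one fixed M it fails, e.g. flat with θ = 0) and is stated for n ≥ 2 (for n = 1, R' = 0 for all λ); the ''if'' part and formulas hold for each M and n ≥ 1. *)

(* Defs.v *)
From HB Require Import structures.
From mathcomp Require Import all_boot all_order all_algebra.
From mathcomp Require Import all_classical all_reals all_analysis.
From mathcomp Require Import ring.

Set Implicit Arguments.
Unset Strict Implicit.
Unset Printing Implicit Defensive.

Import Order.TTheory GRing.Theory Num.Theory.
Import numFieldNormedType.Exports.

Local Open Scope classical_set_scope.
Local Open Scope ring_scope.

Definition partial (R : realType) (m : nat) (i : 'I_m) (f : 'rV[R]_m -> R) :
  'rV[R]_m -> R := fun x => 'D_(delta_mx 0 i) f x.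

(* [f] is only inspected at points of [U] and, [U] being open in all uses, in
   their neighbourhoods: values outside [U] do not matter. *)
Fixpoint Ck_on (R : realType) (m k : nat) (U : set 'rV[R]_m)
    (f : 'rV[R]_m -> R) : Prop :=
  (forall x, U x -> {for x, continuous f}) /\
  match k with
  | 0 => True
  | k'.+1 => forall i : 'I_m,
      (forall x, U x -> derivable f x (delta_mx 0 i)) /\
      Ck_on k' U (partial i f)
  end.

Definition smooth_on (R : realType) (m : nat) (U : set 'rV[R]_m)
  (f : 'rV[R]_m -> R) : Prop := forall k, Ck_on k U f.

Section SmoothOn.
Context (R : realType) (m : nat) (U : set 'rV[R]_m) (oU : open U).
Implicit Types f g : 'rV[R]_m -> R.

Lemma eq_Ck_on k f g :
  (forall x, U x -> f x = g x) -> Ck_on k U f -> Ck_on k U g.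
Proof.
have near_fg f' g' x : (forall x, U x -> f' x = g' x) -> U x ->
    \forall y \near x, f' y = g' y.
  by move=> fg Ux; near=> y; apply: fg; near: y; exact: open_nbhs_nbhs.
have cont f' g' x : (forall x, U x -> f' x = g' x) -> U x ->
    {for x, continuous f'} -> {for x, continuous g'}.
  move=> fg Ux; rewrite /prop_for /continuous_at -(fg x Ux) => cf.
  by apply: cvg_trans cf; exact: (near_eq_cvg (near_fg _ _ _ fg Ux)).
elim: k f g => [|k IH] f g fg [cf df]; split=> //.
- by move=> x Ux; apply: cont (cf x Ux).
- by move=> x Ux; apply: cont (cf x Ux).
move=> i; have [dfi Cfi] := df i; split=> [x Ux|].
  by apply: near_eq_derivable (dfi x Ux); exact: (near_fg _ _ _ fg Ux).
by apply: IH Cfi => x Ux; apply: near_eq_derive; exact: (near_fg _ _ _ fg Ux).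
Unshelve. all: by end_near. Qed.

Lemma Ck_onS k f : Ck_on k.+1 U f -> Ck_on k U f.
Proof.
elim: k f => [|k IH] f [cf df]; split=> // i.
by have [dfi Cfi] := df i; split=> //; exact: IH.
Qed.

Lemma Ck_on_cst k (a : R) : Ck_on k U (cst a).
Proof.
elim: k a => [|k IH] a; first by split=> // x _; exact: cst_continuous.
split=> [x _|i]; first exact: cst_continuous.
split=> [x _|]; first exact: derivable_cst.
by apply: eq_Ck_on (IH 0) => x _; rewrite /partial derive_cst.
Qed.

Lemma Ck_onD k f g : Ck_on k U f -> Ck_on k U g -> Ck_on k U (f + g).
Proof.
elim: k f g => [|k IH] f g [cf df] [cg dg].
  by split=> // x Ux; exact: (continuousD (cf x Ux) (cg x Ux)).
split=> [x Ux|i]; first by exact: (continuousD (cf x Ux) (cg x Ux)).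
have [dfi Cfi] := df i; have [dgi Cgi] := dg i.
split=> [x Ux|]; first by apply: derivableD; [exact: dfi|exact: dgi].
apply: eq_Ck_on (IH _ _ Cfi Cgi) => x Ux.
by rewrite /partial deriveD //; [exact: dfi|exact: dgi].
Qed.

Lemma Ck_onM k f g : Ck_on k U f -> Ck_on k U g -> Ck_on k U (f * g).
Proof.
elim: k f g => [|k IH] f g Cf Cg; have [cf df] := Cf; have [cg dg] := Cg.
  by split=> // x Ux; exact: (continuousM (cf x Ux) (cg x Ux)).
split=> [x Ux|i]; first by exact: (continuousM (cf x Ux) (cg x Ux)).
have [dfi Cfi] := df i; have [dgi Cgi] := dg i.
split=> [x Ux|]; first by apply: derivableM; [exact: dfi|exact: dgi].
have := Ck_onD (IH _ _ (Ck_onS Cf) Cgi) (IH _ _ (Ck_onS Cg) Cfi).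
apply: eq_Ck_on => x Ux.
by rewrite /partial deriveM //; [exact: dfi|exact: dgi].
Qed.

End SmoothOn.

Record chart (R : realType) (T : topologicalType) (m : nat) := Chart {
  chart_dom : set T;
  chart_map : T -> 'rV[R]_m;
  chart_inv : 'rV[R]_m -> T;
  chart_dom_open : open chart_dom;
  chart_img_open : open (chart_map @` chart_dom);
  chart_mapK : forall p, chart_dom p -> chart_inv (chart_map p) = p;
  chart_map_continuous : {within chart_dom, continuous chart_map};
  chart_inv_continuous :
    {within chart_map @` chart_dom, continuous chart_inv} }.

Definition chart_img (R : realType) (T : topologicalType) (m : nat)
  (c : chart R T m) : set 'rV[R]_m := chart_map c @` chart_dom c.

(* The atlas need not be maximal: any smooth atlas determines the structure. *)
Record manifold (R : realType) (m : nat) := Manifold {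
  points :> topologicalType;
  points_hausdorff : hausdorff_space points;
  points_second_countable : @second_countable points;
  atlas : set (chart R points m);
  atlas_cover : forall p, exists2 c, atlas c & chart_dom c p;
  atlas_smooth : forall c c', atlas c -> atlas c' -> forall i : 'I_m,
    smooth_on (chart_map c @` (chart_dom c `&` chart_dom c'))
      (fun v => chart_map c' (chart_inv c v) 0 i) }.

Section SmoothFunctions.
Context (R : realType) (m : nat) (M : manifold R m).

Definition smooth (f : M -> R) : Prop :=
  forall c, atlas c -> smooth_on (chart_img c) (f \o chart_inv c).

Definition smoothb : {pred M -> R} := fun f => `[< smooth f >].

Lemma smoothb_subring : subring_closed smoothb.
Proof.
have cstS a : smooth (cst a).
  by move=> c _ k; exact: (@Ck_on_cst _ _ _ (@chart_img_open _ _ _ c)).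
have mulS f g : smooth f -> smooth g -> smooth (f * g).
  move=> Sf Sg c Ac k.
  exact: (Ck_onM (@chart_img_open _ _ _ c) (Sf c Ac k) (Sg c Ac k)).
split=> [|f g /asboolP Sf /asboolP Sg|f g /asboolP Sf /asboolP Sg].
- exact/asboolP/(cstS 1).
- apply/asboolP; have -> : f - g = f + cst (-1) * g.
    by apply/funext => p /=; rewrite !fctE mulN1r.
  move=> c Ac k; apply: (Ck_onD (@chart_img_open _ _ _ c) (Sf c Ac k)).
  exact: mulS.
- exact/asboolP/mulS.
Qed.

HB.instance Definition _ :=
  GRing.isSubringClosed.Build (M -> R) smoothb smoothb_subring.

Record Cinf := MkCinf { Cinf_fun :> M -> R; _ : smoothb Cinf_fun }.

HB.instance Definition _ := [isSub for Cinf_fun].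
HB.instance Definition _ := [Choice of Cinf by <:].
HB.instance Definition _ :=
  GRing.SubChoice_isSubComPzRing.Build _ _ Cinf smoothb_subring.

Lemma smoothb_cst (a : R) : smoothb (cst a).
Proof.
apply/asboolP => c _ k.
exact: (@Ck_on_cst _ _ _ (@chart_img_open _ _ _ c)).
Qed.

Definition cfun (a : R) : Cinf := MkCinf (smoothb_cst a).

End SmoothFunctions.

Notation "a %:F" := (cfun _ a) (at level 1, format "a %:F") : ring_scope.

(* Vector fields are the R-linear derivations of C^infinity(M); the value of [x]
   at [p] is the derivation at [p] given by [fun f => x f p]. *)

Record vfield (R : realType) (m : nat) (M : manifold R m) := MkVfield {
  vf_fun :> Cinf M -> Cinf M;
  vf_linear : forall (a : R) f g,
    vf_fun (a%:F * f + g) = a%:F * vf_fun f + vf_fun g;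
  vf_leibniz : forall f g, vf_fun (f * g) = vf_fun f * g + f * vf_fun g }.

Section VectorFields.
Context (R : realType) (m : nat) (M : manifold R m).
Implicit Types (f g h : Cinf M) (x y z : vfield M).

Lemma vfieldP x y : (forall f, x f = y f) -> x = y.
Proof.
case: x y => [x xl xd] [y yl yd] /= xy.
have {}xy : x = y by exact/funext.
by subst y; congr MkVfield; exact: Prop_irrelevance.
Qed.

Program Definition vf_zero : vfield M := @MkVfield _ _ _ (fun=> 0) _ _.
Next Obligation. by move=> * /=; rewrite mulr0 addr0. Qed.
Next Obligation. by move=> * /=; rewrite mul0r mulr0 addr0. Qed.

Program Definition vf_opp x : vfield M := @MkVfield _ _ _ (fun f => - x f) _ _.
Next Obligation. by move=> * /=; rewrite vf_linear opprD mulrN. Qed.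
Next Obligation. by move=> * /=; rewrite vf_leibniz opprD mulrN mulNr. Qed.

Program Definition vf_add x y : vfield M :=
  @MkVfield _ _ _ (fun f => x f + y f) _ _.
Next Obligation. by move=> * /=; rewrite !vf_linear addrACA mulrDr. Qed.
Next Obligation. by move=> * /=; rewrite !vf_leibniz addrACA mulrDl mulrDr. Qed.

Program Definition vf_scale h x : vfield M :=
  @MkVfield _ _ _ (fun f => h * x f) _ _.
Next Obligation. by move=> * /=; rewrite vf_linear mulrDr mulrCA. Qed.
Next Obligation.
by move=> h x f g /=; rewrite vf_leibniz mulrDr mulrA (mulrCA h f).
Qed.

HB.instance Definition _ := gen_eqMixin (vfield M).
HB.instance Definition _ := gen_choiceMixin (vfield M).

Fact vf_addA : associative vf_add.
Proof. by move=> x y z; apply: vfieldP => f /=; rewrite addrA. Qed.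
Fact vf_addC : commutative vf_add.
Proof. by move=> x y; apply: vfieldP => f /=; rewrite addrC. Qed.
Fact vf_add0 : left_id vf_zero vf_add.
Proof. by move=> x; apply: vfieldP => f /=; rewrite add0r. Qed.
Fact vf_addN : left_inverse vf_zero vf_opp vf_add.
Proof. by move=> x; apply: vfieldP => f /=; rewrite addNr. Qed.

HB.instance Definition _ :=
  GRing.isZmodule.Build (vfield M) vf_addA vf_addC vf_add0 vf_addN.

Fact vf_scaleA f g x : vf_scale f (vf_scale g x) = vf_scale (f * g) x.
Proof. by apply: vfieldP => h /=; rewrite mulrA. Qed.
Fact vf_scale1 : left_id 1 vf_scale.
Proof. by move=> x; apply: vfieldP => h /=; rewrite mul1r. Qed.
Fact vf_scaleDr : right_distributive vf_scale +%R.
Proof. by move=> f x y; apply: vfieldP => h /=; rewrite mulrDr. Qed.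
Fact vf_scaleDl x : {morph vf_scale^~ x : f g / f + g}.
Proof. by move=> f g; apply: vfieldP => h /=; rewrite mulrDl. Qed.

HB.instance Definition _ := GRing.Zmodule_isLmodule.Build (Cinf M) (vfield M)
  vf_scaleA vf_scale1 vf_scaleDr vf_scaleDl.

Program Definition bracket x y : vfield M :=
  @MkVfield _ _ _ (fun f => x (y f) - y (x f)) _ _.
Next Obligation. by move=> * /=; rewrite !vf_linear opprD addrACA mulrBr. Qed.
Next Obligation.
have vfD (v : vfield M) (p q : Cinf M) : v (p + q) = v p + v q.
  have /= := vf_linear v 1 p q; have -> : (1%:F : Cinf M) = 1 by exact: val_inj.
  by rewrite !mul1r.
move=> x y f g /=; rewrite !vf_leibniz !vfD !vf_leibniz mulrBl mulrBr; ring.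
Qed.

End VectorFields.

(* Covariant tensor fields are C^infinity(M)-multilinear maps from vector fields
   to C^infinity(M): on a Hausdorff second countable manifold these are the same
   as smooth families of multilinear forms on the tangent spaces. *)

Notation oneform M := {linear vfield M -> Cinf M | *%R}.

Section Connections.
Context (R : realType) (m : nat) (M : manifold R m).
Implicit Types (D : vfield M -> vfield M -> vfield M)
  (g : vfield M -> vfield M -> Cinf M).

(* The last clause is nondegeneracy at every point: [x] vanishes at [p] as soon
   as it is orthogonal at [p] to all vector fields. The index is not prescribed;
   in [norden_manifold] below it is forced to be (n, n). *)
Definition pseudo_riemannian g : Prop :=
  [/\ forall f x y z, g (f *: x + y) z = f * g x z + g y z,
      forall x y, g x y = g y x
    & forall (p : M) (x : vfield M),
        (forall y, g x y p = 0) -> forall f, x f p = 0].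

Definition connection D : Prop :=
  [/\ forall f x y z, D (f *: x + y) z = f *: D x z + D y z,
      forall x y z, D x (y + z) = D x y + D x z
    & forall (f : Cinf M) (x y : vfield M), D x (f *: y) = x f *: y + f *: D x y].

Definition levi_civita g D : Prop :=
  [/\ connection D,
      forall x y, D x y - D y x = bracket x y
    & forall x y z : vfield M, x (g y z) = g (D x y) z + g y (D x z)].

Definition curvature D (x y z : vfield M) : vfield M :=
  D x (D y z) - D y (D x z) - D (bracket x y) z.

Definition curvature4 g D (x y z u : vfield M) : Cinf M :=
  g (curvature D x y z) u.

Definition nabla1 D (theta : vfield M -> Cinf M) (x y : vfield M) : Cinf M :=
  x (theta y) - theta (D x y).

Definition dform (theta : vfield M -> Cinf M) (x y : vfield M) : Cinf M :=
  x (theta y) - y (theta x) - theta (bracket x y).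

Definition closed_form (theta : vfield M -> Cinf M) : Prop :=
  forall x y, dform theta x y = 0.

(* [e] is a basis of the tangent space at [p]; a basis at [p] is a basis near
    [p], and every local basis near [p] coincides with such an [e] near [p]. *)
Definition frame_at (p : M) (e : 'I_m -> vfield M) : Prop :=
  forall x : vfield M, exists! a : 'rV[R]_m,
    forall f : Cinf M, x f p = \sum_i a 0 i * e i f p.

Definition gram g (e : 'I_m -> vfield M) (p : M) : 'M[R]_m :=
  \matrix_(i, j) g (e i) (e j) p.

(* The trace [g^{ij} B(e_i, e_j, x)] at [p]. *)
Definition metric_trace g (B : vfield M -> vfield M -> vfield M -> Cinf M)
    (e : 'I_m -> vfield M) (p : M) (x : vfield M) : R :=
  \sum_i \sum_j invmx (gram g e p) i j * B (e i) (e j) x p.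

End Connections.

Record norden_manifold (R : realType) (n : nat) := NordenManifold {
  nm_manifold :> manifold R (2 * n);
  nm_J : {linear vfield nm_manifold -> vfield nm_manifold};
  nm_g : vfield nm_manifold -> vfield nm_manifold -> Cinf nm_manifold;
  nm_J2 : forall x, nm_J (nm_J x) = - x;
  nm_metric : pseudo_riemannian nm_g;
  nm_norden : forall x y, nm_g (nm_J x) (nm_J y) = - nm_g x y }.

Section Norden.
Context (R : realType) (n : nat) (M : norden_manifold R n).
Notation VF := (vfield M).
Notation J := (nm_J M).
Notation g := (@nm_g _ _ M).
Notation tensor2 := (VF -> VF -> Cinf M).
Notation tensor4 := (VF -> VF -> VF -> VF -> Cinf M).
Implicit Types (D : VF -> VF -> VF) (theta : oneform M) (Omega : VF).

Definition gtilde : tensor2 := fun x y => g x (J y).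

Definition complex_connection D : Prop :=
  connection D /\ forall x y, D x (J y) = J (D x y).

Definition tensorF D (x y z : VF) : Cinf M := g (D x (J y) - J (D x y)) z.

Definition lie_form D theta : Prop :=
  forall (p : M) (e : 'I_(2 * n) -> VF) (x : VF), frame_at p e ->
    theta x p = metric_trace g (tensorF D) e p x.

Definition lie_vector theta Omega : Prop := forall x, theta x = g x Omega.

Definition W1 D theta : Prop := forall x y z,
  tensorF D x y z =
  ((2 * n)%:R^-1)%:F *
    (g x y * theta z + g x (J y) * theta (J z)
     + g x z * theta y + g x (J z) * theta (J y)).

Record conformal_kahler D theta Omega : Prop := ConformalKahler {
  ck_levi_civita : levi_civita g D;
  ck_lie_form : lie_form D theta;
  ck_lie_vector : lie_vector theta Omega;
  ck_W1 : W1 D theta;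
  ck_closed : closed_form theta;
  ck_closed_star : closed_form (theta \o J) }.

Definition curvature_like (L : tensor4) : Prop :=
  [/\ forall x y z u, L x y z u = - L y x z u,
      forall x y z u, L x y z u = - L x y u z
    & forall x y z u, L x y z u + L y z x u + L z x y u = 0].

Definition kahler_tensor (L : tensor4) : Prop :=
  curvature_like L /\ forall x y z u, L x y (J z) (J u) = - L x y z u.

Definition psi1 (S : tensor2) : tensor4 := fun x y z u =>
  g y z * S x u - g x z * S y u + g x u * S y z - g y u * S x z.

Definition psi2 (S : tensor2) : tensor4 := fun x y z u =>
  g y (J z) * S x (J u) - g x (J z) * S y (J u)
  + g x (J u) * S y (J z) - g y (J u) * S x (J z).

Definition psi12 (S : tensor2) : tensor4 := fun x y z u =>
  psi1 S x y z u - psi2 S x y z u.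

Definition pi1 : tensor4 := fun x y z u => (2^-1)%:F * psi1 g x y z u.
Definition pi2 : tensor4 := fun x y z u => (2^-1)%:F * psi2 g x y z u.
Definition pi3 : tensor4 := fun x y z u => - psi1 gtilde x y z u.

Definition nabla0 D theta Omega (x y : VF) : VF :=
  D x y + ((2 * n)%:R^-1)%:F *: (theta (J y) *: x - g x y *: J Omega).

Definition nablaQ (l1 l2 l3 l4 l5 l6 l7 l8 : R) theta Omega (x y : VF) : VF :=
  ((2 * n)%:R^-1)%:F *: (theta (J y) *: x - g x y *: J Omega)
  + (n%:R^-1)%:F *:
    (l1%:F *: (theta x *: y) + l2%:F *: (theta x *: J y)
     + l3%:F *: (theta (J x) *: y) + l4%:F *: (theta (J x) *: J y)
     + l5%:F *: (theta y *: x - theta (J y) *: J x)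
     + l6%:F *: (theta y *: J x + theta (J y) *: x)
     + l7%:F *: (g x y *: Omega - g x (J y) *: J Omega)
     + l8%:F *: (g x (J y) *: Omega + g x y *: J Omega)).

Definition nabla' (l1 l2 l3 l4 l5 l6 l7 l8 : R) D theta Omega (x y : VF) : VF :=
  D x y + nablaQ l1 l2 l3 l4 l5 l6 l7 l8 theta Omega x y.

Definition tensorS1 (l7 : R) D theta Omega : tensor2 := fun x y =>
  nabla1 D theta x y
  + (l7 / n%:R)%:F * (theta x * theta y - theta (J x) * theta (J y))
  - (l7 / (2 * n)%:R)%:F * theta Omega * g x y
  + (l7 / (2 * n)%:R)%:F * theta (J Omega) * g x (J y).

Definition tensorS2 (l8 : R) D theta Omega : tensor2 := fun x y =>
  nabla1 D theta x (J y)
  + ((1 - 2 * l8) / (2 * n)%:R)%:F *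
      (theta x * theta y - theta (J x) * theta (J y))
  + (l8 / (2 * n)%:R)%:F * theta Omega * g x y
  + ((1 - l8) / (2 * n)%:R)%:F * theta (J Omega) * g x (J y).

Definition tensorS3 theta : tensor2 := fun x y =>
  theta x * theta (J y) + theta (J x) * theta y.

Definition tensorP D theta Omega : tensor2 := fun x y =>
  nabla1 D theta x (J y)
  + ((2 * n)%:R^-1)%:F * theta x * theta y
  + ((4 * n)%:R^-1)%:F * theta Omega * g x y
  + ((2 * n)%:R^-1)%:F * theta (J Omega) * g x (J y).

End Norden.

(* Main.v *)
Require Import Defs.
From HB Require Import structures.
From mathcomp Require Import all_boot all_order all_algebra.
From mathcomp Require Import all_classical all_reals all_analysis.
From mathcomp Require Import ring lra zify.

Set Implicit Arguments.
Unset Strict Implicit.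
Unset Printing Implicit Defensive.

Import Order.TTheory GRing.Theory Num.Theory.
Import numFieldNormedType.Exports.

Local Open Scope classical_set_scope.
Local Open Scope ring_scope.

(** Paired with g, the curvature of nabla' = D + Q is the curvature of D plus the
    antisymmetrised covariant derivative and the commutator of the trilinear form
    g(Q(x,y),u). On a W1-manifold both are polynomials in g, theta and D theta, so
    the two curvature formulas are polynomial identities. The terms in lambda_1,
    ..., lambda_4 are closed 1-forms times id and J; they commute with a complex
    connection and do not contribute to the curvature. R' is compatible with J
    because nabla' is complex, and its other symmetries can be read off the formula
    since P, S_1, S_2, S_3 are symmetric.

    For the necessity of the two equations, at a point where theta vanishes
    R'(x,y,z,u) + R'(x,y,u,z) is a combination of lambda_5 + lambda_7 and
    lambda_6 + lambda_8 with coefficients given by D theta. These can be separated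
    at the origin of C^n with the metric e^(2u) Re(sum_i dz_i^2), where u is the
    pluriharmonic function Im(z_0^2)/2. Vector fields being derivations of the
    smooth functions, working in coordinates on C^n requires Hadamard's lemma:
    every derivation of C^oo(R^m) is x = sum_i x(X_i) d_i. *)

(** * Integrals over [0, 1] depending on a parameter *)

Section ParametricIntegral.
Context (R : realType).
Local Notation mu := (@lebesgue_measure R).
Local Notation I01 := (`[0%R, 1%R]%classic : set R).

Lemma continuous_integrable01 (f : R -> R) :
  continuous f -> mu.-integrable I01 (EFin \o f).
Proof.
move=> cf; apply: continuous_compact_integrable; first exact: segment_compact.
exact: continuous_subspaceT.
Qed.

Lemma continuous_scale (c : R) (h : R -> R) :
  continuous h -> continuous (fun t => c * h t).
Proof.
by move=> ch t; apply: (@cvgM _ _ _ _ (cst c) h); [exact: cvg_cst|exact: ch].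
Qed.

Definition int01 (f : R -> R) : R := \int[mu]_(t in I01) f t.

Lemma int01_cst (r : R) : int01 (cst r) = r.
Proof.
rewrite /int01 Rintegral_cst //= lebesgue_measure_itv /= lte01 oppr0 adde0.
exact: mulr1.
Qed.

(** Both continuity and differentiation under the integral sign reduce to this uniform estimate. *)
Lemma int01_near (f g : R -> R) e : continuous f -> continuous g ->
  (forall t, I01 t -> `|f t - g t| <= e) -> `|int01 f - int01 g| <= e.
Proof.
move=> cf cg fg; rewrite /int01 -RintegralB //; try exact: continuous_integrable01.
have cfg : continuous (fun t => f t - g t).
  by move=> t; apply: continuousB; [exact: cf|exact: cg].
apply: le_trans (le_normr_Rintegral _ _) _ => //.
  exact: continuous_integrable01.
rewrite -[leRHS]int01_cst /int01.
apply: le_Rintegral => //.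
- apply: continuous_integrable01 => t.
  exact/(cvg_comp _ _ (cfg t))/norm_continuous.
- by apply: continuous_integrable01 => t; exact: cst_continuous.
Qed.

Lemma int01D (f g : R -> R) a b : continuous f -> continuous g ->
  int01 (fun t => a * f t + b * g t) = a * int01 f + b * int01 g.
Proof.
move=> cf cg.
rewrite /int01 RintegralD ?RintegralZl //; apply: continuous_integrable01 => //;
  exact: continuous_scale.
Qed.

Lemma int01_FTC (F f : R -> R) : continuous f ->
  (forall t : R, is_derive t 1 F (f t)) -> int01 f = F 1 - F 0.
Proof.
move=> cf dF; rewrite /int01 /Rintegral (@continuous_FTC2 _ f F) //.
- exact: continuous_subspaceT.
- have cF : continuous F.
    move=> t; apply/differentiable_continuous/derivable1_diffP.
    by case: (dF t).
  split => [x _||]; first by case: (dF x).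
  + exact/cvg_at_right_filter/cF.
  + exact/cvg_at_left_filter/cF.
- by move=> t _; rewrite derive1E; case: (dF t).
Qed.

Section Param.
Context (E : normedModType R).

(** Compactness of [0, 1], in its near-covering form, turns joint continuity into an estimate
    uniform in t. *)
Lemma near_uniform01 (F : R -> E -> R) (x : E) (e : R) :
  (forall z : R * E, {for z, continuous (fun z : R * E => F z.1 z.2)}) -> 0 < e ->
  \forall y \near x, forall t, I01 t -> `|F t y - F t x| < e.
Proof.
move=> cF e0.
have /compact_near_coveringP := @segment_compact R 0 1.
move=> /(_ E (nbhs x) (fun y t => `|F t y - F t x| < e)); apply => t _.
have e20 : 0 < e / 2 by rewrite divr_gt0.
have /cvgrPdist_lt/(_ _ e20) := cF (t, x).
move=> -[[A B] /= [At Bx] AB].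
exists (A, B) => //= -[t' y] /= [At' By].
have h1 := AB (t', y) (conj At' By).
have h2 := AB (t', x) (conj At' (nbhs_singleton Bx)).
rewrite /= in h1 h2.
by rewrite (le_lt_trans (ler_distD (F t x) _ _)) // (splitr e) ltrD // distrC.
Qed.

Lemma continuous_slice (F : R -> E -> R) y :
  (forall z : R * E, {for z, continuous (fun z : R * E => F z.1 z.2)}) ->
  continuous (F ^~ y).
Proof.
move=> cF t.
have h : (fun t => (t, y)) @ t --> (t, y).
  by apply: (@cvg_pair R R E _ (nbhs t) (nbhs y) _ _ _ id (cst y));
    [exact: cvg_id|exact: cvg_cst].
exact: (cvg_comp (fun t => (t, y)) _ h (cF (t, y))).
Qed.

Lemma continuous_int01 (F : R -> E -> R) :
  (forall z : R * E, {for z, continuous (fun z : R * E => F z.1 z.2)}) ->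
  continuous (fun x => int01 (F ^~ x)).
Proof.
move=> cF x; apply/cvgrPdist_le => e e0.
have cFx y := continuous_slice (y := y) cF.
near=> y; apply: int01_near => // t It.
rewrite distrC; apply: ltW; move: t It; near: y; exact: near_uniform01.
Unshelve. all: by end_near. Qed.

(** The two difference quotients coincide as functions of the increment. The chain rule and the mean
    value theorem in one variable thereby apply to directional derivatives. *)
Lemma is_derive_line (f : E -> R) (x v : E) (s l : R) :
  is_derive (s *: v + x) v f l <-> is_derive s (1:R) (fun h => f (h *: v + x)) l.
Proof.
have eqq : (fun h : R => h^-1 *: ((f \o shift (s *: v + x)) (h *: v)
      - f (s *: v + x)))
    = (fun h => h^-1 *: (((fun h => f (h *: v + x)) \o shift s) (h *: (1:R))
      - f (s *: v + x))).
  by apply/funext => h /=; rewrite [h%:A]mulr1 scalerDl addrA.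
by split=> -[df dfl]; split; move: df dfl; rewrite /derivable /derive eqq.
Qed.

(** By the mean value theorem the difference quotient of [F t] along v is the value of [G t] at
    [s *: v + x] for some s between 0 and h. This is close to [G t x] uniformly in t, so the
    quotients of the integrals converge. *)
Lemma is_derive_int01 (F G : R -> E -> R) (x v : E) :
  (forall z : R * E, {for z, continuous (fun z : R * E => F z.1 z.2)}) ->
  (forall z : R * E, {for z, continuous (fun z : R * E => G z.1 z.2)}) ->
  (forall t y, is_derive y v (F t) (G t y)) ->
  is_derive x v (fun x => int01 (F ^~ x)) (int01 (G ^~ x)).
Proof.
move=> cF cG dF.
suff H : (fun h : R => h^-1 *: (((fun x => int01 (F ^~ x)) \o shift x) (h *: v)
    - int01 (F ^~ x))) @ 0^' --> int01 (G ^~ x).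
  split; first by apply/cvg_ex; eexists; exact: H.
  exact: (cvg_lim _ H).
apply/cvgrPdist_le => e e0.
have nu := near_uniform01 x cG e0.
have /nbhs_ballP[r /= r0 nr] :
  \forall h \near (0:R), forall t, I01 t -> `|G t (h *: v + x) - G t x| < e.
  have : (fun h : R => h *: v + x) @ (0:R) --> x.
    have := cvgD (@scalel_continuous R E v (0 : R)) (@cvg_cst E x R (nbhs (0 : R)) _).
    by rewrite scale0r add0r; apply; exact: nbhs_filter.
  by move=> /(_ _ nu).
near=> h.
have h0 : h != 0 by near: h; exact: nbhs_dnbhs_neq.
have hr : `|h| < r.
  near: h; apply: dnbhs0_lt => //.
rewrite /=.
have -> : h^-1 *: (int01 (F ^~ (h *: v + x)) - int01 (F ^~ x))
  = int01 (fun t => h^-1 * F t (h *: v + x) + (- h^-1) * F t x).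
  rewrite -[LHS]/(h^-1 * _).
  by rewrite int01D ?mulrBr ?mulNr //; exact: continuous_slice.
apply: int01_near.
- exact: continuous_slice.
- have h1 := continuous_scale (c := h^-1) (continuous_slice (y := h *: v + x) cF).
  have h2 := continuous_scale (c := - h^-1) (continuous_slice (y := x) cF).
  by move=> t; exact: (cvgD (h1 t) (h2 t)).
move=> t It.
pose f s := F t (s *: v + x).
have df s : is_derive s (1:R) f (G t (s *: v + x)) by apply/is_derive_line.
have cf : continuous f.
  by move=> s; apply/differentiable_continuous/derivable1_diffP; case: (df s).
suff [s sr fs] : exists2 s, `|s| < r & f h - f 0 = G t (s *: v + x) * h.
  have -> : h^-1 * F t (h *: v + x) + - h^-1 * F t x = h^-1 * (f h - f 0).
    by rewrite /f scale0r add0r mulrBr mulNr.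
  rewrite fs mulrC mulfK // distrC; apply/ltW/nr => //.
  by rewrite /ball /= sub0r normrN.
(* [MVT] takes ordered endpoints, so the sign of h is distinguished. *)
have [h_lt|h_gt|h_eq] := ltgtP h 0; last by rewrite h_eq eqxx in h0.
- have [s /[!in_itv] /= /andP[s1 s2] fs] := MVT h_lt (fun s _ => df s)
    (continuous_subspaceT cf).
  exists s; last by rewrite -opprB fs; ring.
  by move: hr; rewrite !ltr0_norm //; lra.
- have [s /[!in_itv] /= /andP[s1 s2] fs] := MVT h_gt (fun s _ => df s)
    (continuous_subspaceT cf).
  exists s; last by rewrite fs; ring.
  by move: hr; rewrite !gtr0_norm //; lra.
Unshelve. all: by end_near. Qed.

End Param.
End ParametricIntegral.
(** * Hadamard's lemma *)

Section RowSpace.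
Context (R : realType) (m : nat).
Local Notation E := 'rV[R]_m.
Local Notation smoothT := (smooth_on (@setT E)).
Implicit Types (f : E -> R) (w : R -> R) (p x : E).

Lemma smoothT_continuous f : smoothT f -> continuous f.
Proof. by move=> /(_ 0)[cf _] x; exact: cf. Qed.

Lemma smoothT_partial i f : smoothT f -> smoothT (partial i f).
Proof. by move=> sf k; have [_ /(_ i)[_]] := sf k.+1. Qed.

Lemma smoothT_is_derive i f x :
  smoothT f -> is_derive x (delta_mx 0 i) f (partial i f x).
Proof. by move=> sf; apply: derivableP; have [_ /(_ i)[+ _]] := sf 1; apply. Qed.

Lemma continuous_row (T : topologicalType) (g : T -> 'I_m -> R) :
  (forall j, continuous (g ^~ j)) -> continuous (fun z => \row_j g z j : E).
Proof.
move=> cg z; apply/cvgrPdist_lt => e e0.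
have ge : \forall y \near z, forall j, `|g z j - g y j| < e.
  by apply: filter_forall => j; have /cvgrPdist_lt/(_ _ e0) := cg j z.
apply: filterS ge => y ge; rewrite -[X in X < _]/(mx_norm _) mx_normrE.
by apply/bigmax_ltP; split=> // -[i j] _; rewrite !mxE.
Qed.

Lemma continuous_comp_fst (U V W : topologicalType) (g : U -> W) :
  continuous g -> continuous (fun z : U * V => g z.1).
Proof.
move=> cg z A /cg Ag; exists (g @^-1` A, setT); last by move=> ? [].
by split=> //; exact: filterT.
Qed.

Lemma continuous_comp_snd (U V W : topologicalType) (g : V -> W) :
  continuous g -> continuous (fun z : U * V => g z.2).
Proof.
move=> cg z A /cg Ag; exists (setT, g @^-1` A); last by move=> ? [].
by split=> //; exact: filterT.
Qed.

(* With c_j in {0, 1, t}, these paths move one coordinate at a time from p to x;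
   a partial derivative only multiplies the weight w in [avg] by c_j, so that [avg]
   preserves smoothness. *)
Definition dpath p (c : 'I_m -> R -> R) (t : R) x : E :=
  \row_j (p 0 j + c j t * (x 0 j - p 0 j)).

Lemma continuous_dpath p c : (forall j, continuous (c j)) ->
  continuous (fun z : R * E => dpath p c z.1 z.2).
Proof.
move=> cc; apply: continuous_row => j z.
apply: cvgD; first exact: cvg_cst.
apply: (@cvgM _ _ _ _ (fun z : R * E => c j z.1) (fun z => z.2 0 j - p 0 j)).
  exact: (continuous_comp_fst (cc j)).
apply: cvgB; last exact: cvg_cst.
exact: (continuous_comp_snd (@coord_continuous R 1 m 0 j)).
Qed.

Lemma dpath_line p c t x i s :
  dpath p c t (s *: delta_mx 0 i + x) = (c i t * s) *: delta_mx 0 i + dpath p c t x.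
Proof.
apply/rowP => j; rewrite !mxE eqxx /= eq_sym.
by have [->|_] := eqVneq i j; rewrite /= ?mulr1n ?mulr0n; ring.
Qed.

Lemma is_derive_scaled_line f y (a s : R) i : smoothT f ->
  is_derive s (1 : R) (fun s => f ((s * a) *: delta_mx 0 i + y))
    (a * partial i f ((s * a) *: delta_mx 0 i + y)).
Proof.
move=> sf; rewrite mulrC.
rewrite -[fun s => _]/((fun s => f (s *: delta_mx 0 i + y)) \o ( *%R^~ a)).
apply: is_derive1_comp.
  apply: (iffLR (is_derive_line f _ _ _ _)).
  exact: smoothT_is_derive.
apply: (is_derive_eq (f' := a *: (1 : R))); last by rewrite [_ *: _]mulr1.
have -> : ( *%R^~ a) = a \*: (@id R) by apply/funext => u /=; rewrite mulrC.
exact: is_deriveZ.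
Qed.

Lemma is_derive_dpath f p c t x i : smoothT f ->
  is_derive x (delta_mx 0 i) (fun x => f (dpath p c t x))
    (c i t * partial i f (dpath p c t x)).
Proof.
move=> sf; have ex : x = 0 *: delta_mx 0 i + x by rewrite scale0r add0r.
rewrite {1}ex; apply: (iffRL (is_derive_line _ _ _ _ _)).
have := @is_derive_scaled_line f (dpath p c t x) (c i t) 0 i sf.
rewrite mul0r scale0r add0r; congr is_derive.
by apply/funext => h; rewrite dpath_line mulrC.
Qed.

Definition avg w p c f : E -> R := fun x => int01 (fun t => w t * f (dpath p c t x)).

Lemma continuous_avg_integrand w p c f :
  continuous w -> (forall j, continuous (c j)) -> continuous f ->
  forall z : R * E,
    {for z, continuous (fun z : R * E => w z.1 * f (dpath p c z.1 z.2))}.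
Proof.
move=> cw cc cf z.
apply: (@cvgM _ _ _ _ (fun z : R * E => w z.1) (fun z => f (dpath p c z.1 z.2))).
  exact: (continuous_comp_fst cw).
exact: (continuous_comp (continuous_dpath (p := p) cc (x := z))
  (cf (dpath p c z.1 z.2))).
Qed.

Lemma smoothT_avg w p c f : continuous w -> (forall j, continuous (c j)) ->
  smoothT f -> smoothT (avg w p c f).
Proof.
(* The induction runs over all weights and all smooth functions at once, because differentiation
   replaces w by [w * c i] and f by [partial i f]. *)
move=> cw cc sf k; elim: k w cw f sf => [|k IH] w cw f sf; split=> //.
- move=> x _; apply: continuous_int01.
  by apply: continuous_avg_integrand => //; exact: smoothT_continuous.
- move=> x _; apply: continuous_int01.
  by apply: continuous_avg_integrand => //; exact: smoothT_continuous.
move=> i.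
have cwc : continuous (fun t => w t * c i t).
  by move=> t; exact: (cvgM (cw t) (cc i t)).
have dI x : is_derive x (delta_mx 0 i) (avg w p c f)
    (avg (fun t => w t * c i t) p c (partial i f) x).
  apply: (@is_derive_int01 _ _ (fun t x => w t * f (dpath p c t x))
    (fun t x => w t * c i t * partial i f (dpath p c t x))).
  - by apply: continuous_avg_integrand => //; exact: smoothT_continuous.
  - exact: (continuous_avg_integrand (w := fun t => w t * c i t) cwc cc
      (smoothT_continuous (smoothT_partial i sf))).
  move=> t y; rewrite -mulrA.
  exact/is_deriveZ/is_derive_dpath.
split=> [x _|]; first by case: (dI x).
apply: (@eq_Ck_on _ _ _ openT _ (avg (fun t => w t * c i t) p c (partial i f))).
  by move=> x _; apply/esym; case: (dI x).
by apply: IH => //; exact: smoothT_partial.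
Qed.

(** The increment f(x) - f(p) is telescoped along a staircase from p to x with edges parallel to the
    axes. On each edge the fundamental theorem of calculus writes the increment as an average of one
    partial derivative, so only the one-variable chain rule enters. *)
Lemma Hadamard f p : smoothT f -> exists h : 'I_m -> E -> R,
  [/\ forall i, smoothT (h i), forall i, h i p = partial i f p
    & forall x, f x = f p + \sum_i (x 0 i - p 0 i) * h i x].
Proof.
move=> sf.
(* On the i-th edge the coordinates before i have reached x, coordinate i moves, and the later ones
   are still those of p. *)
pose c (i j : 'I_m) : R -> R :=
  if (j < i)%N then cst 1 else if j == i then id else cst 0.
have cc i j : continuous (c i j).
  rewrite /c; case: ifP => _; first exact: cst_continuous.
  by case: ifP => _; [move=> t; exact: cvg_id|exact: cst_continuous].
exists (fun i => avg (cst 1) p (c i) (partial i f)); split.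
- by move=> i; apply: smoothT_avg => //; [exact: cst_continuous|exact: smoothT_partial].
(* For x = p all the paths are constant, so the average is the value at p. *)
- move=> i; rewrite /avg.
  have -> : (fun t => cst 1 t * partial i f (dpath p (c i) t p)) =
      cst (partial i f p).
    apply/funext => t /=; rewrite mul1r; congr partial.
    by apply/rowP => j; rewrite mxE subrr mulr0 addr0.
  by rewrite int01_cst.
move=> x.
(* The corners of the staircase, from [y 0] = p to [y m] = x. *)
pose y k : E := \row_j (if (j < k)%N then x 0 j else p 0 j).
have -> : p = y 0 by apply/rowP => j; rewrite mxE.
have {1}-> : x = y m by apply/rowP => j; rewrite mxE ltn_ord.
suff step i : (x 0 i - y 0 0 i) * avg (cst 1) (y 0) (c i) (partial i f) x
  = f (y i.+1) - f (y i).
  under eq_bigr => i _ do rewrite step.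
  by rewrite -(big_mkord xpredT (fun i => f (y i.+1) - f (y i))) telescope_sumr //;
    rewrite addrC subrK.
rewrite /avg.
have -> : y 0 = p by apply/rowP => j; rewrite mxE.
have y0 : y i = dpath p (c i) 0 x.
  apply/rowP => j; rewrite !mxE /c; case: ltnP => _ /=; first by ring.
  by case: ifP => _ /=; ring.
have y1 : y i.+1 = dpath p (c i) 1 x.
  apply/rowP => j; rewrite !mxE /c ltnS leq_eqVlt.
  have [ji|ji|/val_inj ->] := ltngtP j i.
  - by rewrite /=; ring.
  - by rewrite -val_eqE gtn_eqF //=; ring.
  - by rewrite eqxx /=; ring.
have cp : continuous (fun t => partial i f (dpath p (c i) t x)).
  have cz : forall z : R * E,
      {for z, continuous (fun z : R * E => partial i f (dpath p (c i) z.1 z.2))}.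
    move=> z.
    have h2 := smoothT_continuous (smoothT_partial i sf) (x := dpath p (c i) z.1 z.2).
    exact: (continuous_comp (continuous_dpath (p := p) (cc i) (x := z)) h2).
  exact: (continuous_slice (F := fun t x => partial i f (dpath p (c i) t x)) cz).
have dF t : is_derive t (1 : R) (fun t => f (dpath p (c i) t x))
    ((x 0 i - p 0 i) * partial i f (dpath p (c i) t x)).
  have yE u : dpath p (c i) u x = (u * (x 0 i - p 0 i)) *: delta_mx 0 i
      + dpath p (c i) 0 x.
    apply/rowP => j; rewrite !mxE /c eqxx /=.
    have [->|ji] := eqVneq j i; first by rewrite ltnn /=; ring.
    by case: ifP => _; rewrite /=; ring.
  have := @is_derive_scaled_line f (dpath p (c i) 0 x) (x 0 i - p 0 i) t i sf.
  rewrite -yE; congr is_derive.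
  by apply/funext => u; rewrite -yE.
rewrite y0 y1 -(int01_FTC _ dF); last first.
  by move=> t; exact: (cvgM (cvg_cst _) (cp t)).
(* With second coefficient 0, [int01D] gives homogeneity of the integral. *)
have := int01D (x 0 i - p 0 i) 0 cp cp.
rewrite mul0r addr0 => int01Z.
have -> : (fun t => cst 1 t * partial i f (dpath p (c i) t x)) =
  fun t => partial i f (dpath p (c i) t x).
  by apply/funext => t; rewrite mul1r.
rewrite -int01Z; congr int01; apply/funext => t /=.
by rewrite mul0r addr0.
Qed.
End RowSpace.
(** * Derivations of the smooth functions on R^m *)

Section VfieldTheory.
Context (R : realType) (m : nat) (M : manifold R m).
Implicit Types (f g : Cinf M) (x y z : vfield M).

Lemma cfun1 : (1%:F : Cinf M) = 1. Proof. exact: val_inj. Qed.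
Lemma cfunD a b : ((a + b)%:F : Cinf M) = a%:F + b%:F. Proof. exact: val_inj. Qed.
Lemma cfunM a b : ((a * b)%:F : Cinf M) = a%:F * b%:F. Proof. exact: val_inj. Qed.
Lemma cfunN a : ((- a)%:F : Cinf M) = - a%:F.
Proof. by apply: val_inj; apply/funext. Qed.
Lemma cfun0 : (0%:F : Cinf M) = 0. Proof. exact: val_inj. Qed.

Lemma vfD x f g : x (f + g) = x f + x g.
Proof. by have := vf_linear x 1 f g; rewrite cfun1 !mul1r. Qed.

Lemma vf0 x : x 0 = 0.
Proof. by apply: (addrI (x 0)); rewrite -vfD !addr0. Qed.

Lemma vfZ x a f : x (a%:F * f) = a%:F * x f.
Proof. by have := vf_linear x a f 0; rewrite vf0 !addr0. Qed.

Lemma vfN x f : x (- f) = - x f.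
Proof. by apply: (addrI (x f)); rewrite -vfD !subrr vf0. Qed.

Lemma vfB x f g : x (f - g) = x f - x g.
Proof. by rewrite vfD vfN. Qed.

Lemma vf_cfun x a : x a%:F = 0.
Proof.
have x1 : x 1 = 0.
  have := vf_leibniz x 1 1; rewrite !mulr1 mul1r => h.
  by apply: (addrI (x 1)); rewrite addr0.
by rewrite -[a%:F]mulr1 vfZ x1 mulr0.
Qed.

Lemma vf_sum x (I : Type) (r : seq I) (P : pred I) (F : I -> Cinf M) :
  x (\sum_(i <- r | P i) F i) = \sum_(i <- r | P i) x (F i).
Proof. by apply: (big_morph x (vfD x) (vf0 x)). Qed.

Lemma vf_addE x y f : (x + y) f = x f + y f. Proof. by []. Qed.
Lemma vf_oppE x f : (- x) f = - x f. Proof. by []. Qed.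
Lemma vf_scaleE g x f : (g *: x) f = g * x f. Proof. by []. Qed.
Lemma vf_sumE (I : Type) (r : seq I) (P : pred I) (F : I -> vfield M) f :
  (\sum_(i <- r | P i) F i) f = \sum_(i <- r | P i) F i f.
Proof. by apply: (big_morph (fun x : vfield M => x f)). Qed.

Lemma CinfP f g : (forall p, f p = g p) -> f = g.
Proof. by move=> fg; apply: val_inj; apply/funext. Qed.

Lemma Cinf_addE f g p : (f + g) p = f p + g p. Proof. by []. Qed.
Lemma Cinf_mulE f g p : (f * g) p = f p * g p. Proof. by []. Qed.
Lemma Cinf_oppE f p : (- f) p = - f p. Proof. by []. Qed.
Lemma Cinf_sumE (I : Type) (r : seq I) (P : pred I) (F : I -> Cinf M) p :
  (\sum_(i <- r | P i) F i) p = \sum_(i <- r | P i) F i p.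
Proof. by apply: (big_morph (fun f : Cinf M => f p)). Qed.

End VfieldTheory.

(** * R^m as a manifold with one global chart *)

Section EuclideanSpace.
Context (R : realType) (m : nat).
Local Notation E := 'rV[R]_m.
Local Notation smoothT := (smooth_on (@setT E)).

(** A countable base is formed by the sup-norm balls with rational centre and radius 1/(k+1). *)
Lemma row_second_countable : @second_countable E.
Proof.
pose U (ck : 'rV[rat]_m * nat) : set E :=
  [set x | forall j, `|x 0 j - ratr (ck.1 0 j)| < ck.2.+1%:R^-1].
exists (range U); first exact/(sub_countable (card_image_le _ _))/countableP.
split.
  move=> _ [[c k] _ <-]; rewrite openE => x Ux.
  have nU j : nbhs x [set y : E | `|y 0 j - ratr (c 0 j)| < k.+1%:R^-1].
    apply: (@coord_continuous R 1 m 0 j x [set v | `|v - ratr (c 0 j)| < k.+1%:R^-1]).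
    apply/nbhs_ballP; exists (k.+1%:R^-1 - `|x 0 j - ratr (c 0 j)|) => /=.
      by rewrite subr_gt0; exact: Ux.
    move=> v; rewrite /ball /= => xv.
    have := ler_distD (x 0 j) v (ratr (c 0 j)); rewrite (distrC v (x 0 j)).
    by move=> /le_lt_trans; apply; rewrite -ltrBrDr.
  exact: filter_forall nU.
move=> x A /nbhs_ballP[e /= e0 xA].
(* A radius below e/2 suffices: x and y both lie within it of the rational centre, hence within e of
   each other. *)
have e20 : 0 < e / 2 by rewrite divr_gt0.
have [k] := ltr_add_invr e20; rewrite add0r => ke.
have [d dE d0] : exists2 d : R, d = k.+1%:R^-1 & 0 < d.
  by exists k.+1%:R^-1; rewrite ?invr_gt0.
have /choice[c xc] : forall j, exists q : rat, `|x 0 j - ratr q| < d.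
  move=> j; have [|q] := @rat_in_itvoo R (x 0 j - d) (x 0 j + d); first by lra.
  by rewrite in_itv /= => /andP[q1 q2]; exists q; rewrite ltr_norml; lra.
exists (U (\row_j c j, k)).
  by split; [exists (\row_j c j, k)|move=> j; rewrite mxE -dE].
move=> y /= Uy; apply: xA; split=> // i j; rewrite (ord1 i).
have := Uy j; rewrite mxE -dE => yc; rewrite -dE in ke.
have := ler_distD (ratr (c j)) (x 0 j) (y 0 j).
by rewrite (distrC (ratr _) (y 0 j)) /ball /=; have := xc j; lra.
Qed.

Program Definition row_chart : chart R E m :=
  @Chart R E m setT id id openT _ _ _ _.
Next Obligation. by rewrite image_id; exact: openT. Qed.
Next Obligation. by []. Qed.
Next Obligation. by apply: continuous_subspaceT => x; exact: cvg_id. Qed.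
Next Obligation. by apply: continuous_subspaceT => x; exact: cvg_id. Qed.

Lemma smoothT_cst (a : R) : smoothT (cst a).
Proof. by move=> k; apply: Ck_on_cst; exact: openT. Qed.

Lemma is_derive_coord (i j : 'I_m) (x : E) :
  is_derive x (delta_mx 0 i) (fun x : E => x 0 j) (i == j)%:R.
Proof.
have ex : x = 0 *: delta_mx 0 i + x by rewrite scale0r add0r.
rewrite {1}ex; apply: (iffRL (is_derive_line _ _ _ _ _)).
have -> : (fun h : R => (h *: delta_mx 0 i + x) 0 j) = 
  (i == j)%:R \*: (@id R) + cst (x 0 j).
  by apply/funext => h /=; rewrite !mxE eqxx /= mulrC eq_sym.
apply: (is_derive_eq (f' := (i == j)%:R *: (1 : R) + 0)).
by rewrite addr0 [_ *: _]mulr1.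
Qed.

Lemma smoothT_coord (j : 'I_m) : smoothT (fun x : E => x 0 j).
Proof.
case=> [|k]; split=> //; try by move=> x _; exact: coord_continuous.
move=> i; split=> [x _|]; first by case: (is_derive_coord i j x).
apply: (@eq_Ck_on _ _ _ openT _ (cst (i == j)%:R)).
  by move=> x _; apply/esym; case: (is_derive_coord i j x).
exact: smoothT_cst.
Qed.

Program Definition row_manifold : manifold R m :=
  @Manifold R m E _ row_second_countable [set row_chart] _ _.
Next Obligation. exact: norm_hausdorff. Qed.
Next Obligation. by exists row_chart. Qed.
Next Obligation.
move=> c c' -> -> i /=; rewrite setTI image_id; exact: smoothT_coord.
Qed.

End EuclideanSpace.
(** * The curvature of nabla' *)

Section ConformalKahler.
Context (R : realType) (n : nat) (hn : (0 < n)%N) (M : norden_manifold R n).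
Context (D : vfield M -> vfield M -> vfield M) (theta : oneform M) (Omega : vfield M).
Hypothesis ck : conformal_kahler D theta Omega.
Local Notation J := (nm_J M).
Local Notation g := (@nm_g _ _ M).
Local Notation N := (nabla1 D theta).
Implicit Types (f h : Cinf M) (x y z u v w : vfield M).

Let connD : connection D. Proof. by case: ck => -[]. Qed.

Lemma metricDl x y z : g (x + y) z = g x z + g y z.
Proof.
by have [/(_ 1 x y z) + _ _] := nm_metric M; rewrite scale1r mul1r.
Qed.
Lemma metricC x y : g x y = g y x. Proof. by case: (nm_metric M). Qed.
Lemma metric0l z : g 0 z = 0.
Proof. by apply: (addrI (g 0 z)); rewrite -metricDl !addr0. Qed.
Lemma metricZl f x z : g (f *: x) z = f * g x z.
Proof.
by have [/(_ f x 0 z) + _ _] := nm_metric M; rewrite metric0l !addr0.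
Qed.
Lemma metricNl x z : g (- x) z = - g x z.
Proof. by rewrite -scaleN1r metricZl mulN1r. Qed.
Lemma metricDr x y z : g x (y + z) = g x y + g x z.
Proof. by rewrite !(metricC x) metricDl. Qed.
Lemma metricZr f x z : g x (f *: z) = f * g x z.
Proof. by rewrite !(metricC x) metricZl. Qed.
Lemma metricNr x z : g x (- z) = - g x z.
Proof. by rewrite !(metricC x) metricNl. Qed.
Definition metricE := (metricDl, metricDr, metricZl, metricZr, metricNl, metricNr).

(** The Norden identity at x and J y, with J^2 = -1: J is self-adjoint, so gtilde is symmetric. *)
Lemma metricJl x y : g (J x) y = g x (J y).
Proof.
by apply: oppr_inj; rewrite -metricNr -(nm_J2 y) nm_norden.
Qed.
Lemma metricJC x y : g x (J y) = g y (J x).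
Proof. by rewrite metricC metricJl. Qed.

Lemma connDr x y z : D x (y + z) = D x y + D x z. Proof. by case: connD. Qed.
Lemma connZr x f z : D x (f *: z) = x f *: z + f *: D x z.
Proof. by case: connD. Qed.
Lemma connNr x z : D x (- z) = - D x z.
Proof.
by rewrite -scaleN1r connZr vfN -cfun1 vf_cfun oppr0 scale0r add0r cfun1 scaleN1r.
Qed.

Lemma vf_metric x y z : x (g y z) = g (D x y) z + g y (D x z).
Proof. by case: ck => -[]. Qed.

Lemma bracketE x y : bracket x y = D x y - D y x.
Proof. by case: ck => -[]. Qed.

(* All the coefficients of the statement are integral polynomials in d, which lets
   [ring] decide the identities below. *)
Local Notation d := (((4 * n)%:R^-1)%:F : Cinf M).

Lemma natrV2 : ((2 * n)%:R^-1)%:F = d + d.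
Proof.
rewrite -cfunD; congr _%:F; rewrite !natrM.
have n0 : (n%:R : R) != 0 by rewrite pnatr_eq0 -lt0n.
by field.
Qed.
Lemma natrV1 : (n%:R^-1)%:F = d + d + (d + d).
Proof.
rewrite -!cfunD; congr _%:F; rewrite !natrM.
have n0 : (n%:R : R) != 0 by rewrite pnatr_eq0 -lt0n.
by field.
Qed.

Lemma tensorFE x y z : g (D x (J y) - J (D x y)) z =
  (d + d) * (g x y * theta z + g x (J y) * theta (J z)
     + g x z * theta y + g x (J z) * theta (J y)).
Proof. by have := ck_W1 ck x y z; rewrite /tensorF -natrV2. Qed.

Lemma thetaE x : theta x = g x Omega. Proof. exact: (ck_lie_vector ck). Qed.
Lemma metric_Omega x : g x Omega = theta x. Proof. by rewrite thetaE. Qed.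
Lemma metric_JOmega x : g x (J Omega) = theta (J x).
Proof. by rewrite thetaE metricJl. Qed.
Lemma thetaJ2 x : theta (J (J x)) = - theta x.
Proof. by rewrite nm_J2 linearN. Qed.
Lemma metricJ2 x y : g x (J (J y)) = - g x y.
Proof. by rewrite nm_J2 metricNr. Qed.

Lemma vf_theta x y : x (theta y) = N x y + theta (D x y).
Proof. by rewrite /nabla1 subrK. Qed.

Lemma connJ x y : D x (J y) = J (D x y) + (D x (J y) - J (D x y)).
Proof. by rewrite addrC subrK. Qed.

(** The derivative of J enters only through F, which the W1 condition expresses by g, gtilde and
    theta. With the analogous rules for g, theta and theta o J, every derivative of a polynomial in
    these is again one, up to nabla theta. *)
Lemma vf_metricJ x y z : x (g y (J z)) = g (D x y) (J z) + g y (J (D x z))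
  + (d + d) * (g x z * theta y + g x (J z) * theta (J y)
     + g x y * theta z + g x (J y) * theta (J z)).
Proof. by rewrite vf_metric connJ metricDr addrA (metricC y (_ - _)) tensorFE. Qed.

(** Applied to (nabla_x J)y, theta gives F(x, y, Omega); this is where theta(Omega) and theta(J
    Omega) come from. *)
Lemma vf_thetaJ x y : x (theta (J y)) = N x (J y) + theta (J (D x y))
  + (d + d) * (g x y * theta Omega + g x (J y) * theta (J Omega)
     + theta x * theta y + theta (J x) * theta (J y)).
Proof.
rewrite vf_theta connJ linearD /= (thetaE (_ - _)) tensorFE.
rewrite metric_Omega metric_JOmega; ring.
Qed.

Lemma nabla1C x y : N x y = N y x.
Proof.
have := ck_closed ck x y; rewrite /dform bracketE linearB /= /nabla1 => h.
by apply/eqP; rewrite -subr_eq0 -h; apply/eqP; ring.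
Qed.

(** The correction terms in [vf_thetaJ] are symmetric in x and y, so they drop out of the exterior
    derivative of theta o J. *)
Lemma nabla1JC x y : N x (J y) = N y (J x).
Proof.
have := ck_closed_star ck x y; rewrite /dform /= bracketE !linearB /=.
rewrite !vf_thetaJ => h; apply/eqP; rewrite -subr_eq0 -h; apply/eqP.
rewrite (metricC y x) (metricJC y x); ring.
Qed.

Lemma nabla1N x y : N x (- y) = - N x y.
Proof. by rewrite /nabla1 connNr !linearN /= vfN; ring. Qed.
Lemma nabla1J2 x y : N x (J (J y)) = - N x y.
Proof. by rewrite nm_J2 nabla1N. Qed.

(** For D metric and torsion-free, this is R^(D+T) = R^D + (D_x T)_y - (D_y T)_x + [T_x, T_y] paired
    with g. The covariant derivative [dq] of the trilinear form [q] is prescribed by its Leibniz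
    rule, and torsion-freeness cancels the terms with T of the bracket. *)
Lemma metric_curvature_add (T : vfield M -> vfield M -> vfield M) q dq
    (Dp := fun x y => D x y + T x y) :
  (forall x y u, g (T x y) u = q x y u) ->
  (forall x y z u, x (q y z u) = q (D x y) z u + q y (D x z) u + q y z (D x u)
    + dq x y z u) ->
  (forall x y z u, q x (y + z) u = q x y u + q x z u) ->
  (forall x y z u, q (x - y) z u = q x z u - q y z u) ->
  forall x y z u, curvature4 g Dp x y z u =
    curvature4 g D x y z u + dq x y z u - dq y x z u
    + q x (T y z) u - q y (T x z) u.
Proof.
move=> Tq xq qD qB x y z u.
(* Metricity moves the derivative from the vector field [T b c] to the function [q b c w]. *)
have gDT a b c w : g (D a (T b c)) w = q (D a b) c w + q b (D a c) w + dq a b c w.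
  have := vf_metric a (T b c) w; rewrite !Tq xq => h.
  by apply: (addIr (q b c (D a w))); rewrite -h; ring.
rewrite /curvature4 /curvature /Dp bracketE !connDr !metricE !gDT !Tq !qD qB; ring.
Qed.


Lemma cfun_half : (2^-1)%:F + (2^-1)%:F = 1 :> Cinf M.
Proof. by rewrite -cfunD -cfun1; congr _%:F; field. Qed.

Lemma pi1E x y z u : pi1 x y z u = g y z * g x u - g x z * g y u.
Proof.
rewrite /pi1 /psi1 -[RHS]mul1r -cfun_half; ring.
Qed.

Lemma pi2E x y z u : pi2 x y z u = g y (J z) * g x (J u) - g x (J z) * g y (J u).
Proof.
rewrite /pi2 /psi2 -[RHS]mul1r -cfun_half; ring.
Qed.

(** * The trilinear form of Q and its covariant derivative *)

Section Difference.
Context (k5 k6 k7 k8 : R).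
Local Notation Q := (nablaQ 0 0 0 0 k5 k6 k7 k8 theta Omega).

(** For d = 1/(4n), the prefactors [d + d] and [d + d + (d + d)] are 1/(2n) and 1/n. *)
Definition Qform (d l5 l6 l7 l8 : Cinf M) x y u : Cinf M :=
  (d + d) * (theta (J y) * g x u - g x y * theta (J u))
  + (d + d + (d + d)) * (l5 * (theta y * g x u - theta (J y) * g x (J u))
    + l6 * (theta y * g x (J u) + theta (J y) * g x u)
    + l7 * (g x y * theta u - g x (J y) * theta (J u))
    + l8 * (g x (J y) * theta u + g x y * theta (J u))).
Local Notation q := (Qform d k5%:F k6%:F k7%:F k8%:F).

Lemma metric_nablaQ x y u : g (Q x y) u = q x y u.
Proof.
rewrite /nablaQ /Qform natrV2 natrV1 !cfun0 !scale0r !add0r !metricE.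
rewrite (metricC Omega u) metric_Omega (metricC (J Omega) u) metric_JOmega metricJl.
ring.
Qed.

Lemma theta_nablaQ x y : theta (Q x y) = q x y Omega.
Proof. by rewrite thetaE metric_nablaQ. Qed.
Lemma thetaJ_nablaQ x y : theta (J (Q x y)) = q x y (J Omega).
Proof. by rewrite thetaE metricJl metric_nablaQ. Qed.
Lemma metric_nablaQr x y u : g u (Q x y) = q x y u.
Proof. by rewrite metricC metric_nablaQ. Qed.
Lemma metricJ_nablaQ x y u : g u (J (Q x y)) = q x y (J u).
Proof. by rewrite metricJC metric_nablaQ. Qed.

(* The covariant derivatives of gtilde and of theta \o J. *)
Definition dgJ (d : Cinf M) x a b : Cinf M :=
  (d + d) * (g x b * theta a + g x (J b) * theta (J a)
    + g x a * theta b + g x (J a) * theta (J b)).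

Definition dthetaJ (d : Cinf M) x a : Cinf M :=
  N x (J a) + (d + d) * (g x a * theta Omega + g x (J a) * theta (J Omega)
    + theta x * theta a + theta (J x) * theta (J a)).

(** The covariant derivative of [Qform]: g is parallel, so only theta, theta o J and gtilde are
    differentiated. *)
Definition dQform (d l5 l6 l7 l8 : Cinf M) x y z u : Cinf M :=
  (d + d) * (dthetaJ d x z * g y u - g y z * dthetaJ d x u)
  + (d + d + (d + d)) * (l5 * (N x z * g y u - dthetaJ d x z * g y (J u)
        - theta (J z) * dgJ d x y u)
    + l6 * (N x z * g y (J u) + theta z * dgJ d x y u + dthetaJ d x z * g y u)
    + l7 * (g y z * N x u - g y (J z) * dthetaJ d x u - dgJ d x y z * theta (J u))
    + l8 * (g y (J z) * N x u + dgJ d x y z * theta u + g y z * dthetaJ d x u)).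

Lemma vf_Qform x y z u :
  x (q y z u) = q (D x y) z u + q y (D x z) u + q y z (D x u)
    + dQform d k5%:F k6%:F k7%:F k8%:F x y z u.
Proof.
rewrite /Qform /dQform /dgJ /dthetaJ.
rewrite !(vf_leibniz, vfD, vfN, vf_cfun).
rewrite !(vf_metricJ, vf_thetaJ, vf_theta, vf_metric).
ring.
Qed.

Lemma curvature4_nablaQ x y z u :
  curvature4 g (nabla' 0 0 0 0 k5 k6 k7 k8 D theta Omega) x y z u =
  curvature4 g D x y z u + dQform d k5%:F k6%:F k7%:F k8%:F x y z u
  - dQform d k5%:F k6%:F k7%:F k8%:F y x z u + q x (Q y z) u - q y (Q x z) u.
Proof.
apply: metric_curvature_add.
- exact: metric_nablaQ.
- exact: vf_Qform.
- by move=> a b c w; rewrite /Qform !linearD /= !metricDr; ring.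
- by move=> a b c w; rewrite /Qform !metricDl !metricNl; ring.
Qed.

(** In the commutator term, [Q y z] occurs only inside theta and g, hence only through [q y z] at
    Omega, J Omega, x and J x. Expanding in two stages, with the powers of J reduced at each, gives
    [ring] a normalised input. *)
Lemma Qform_nablaQ x y z u : q x (Q y z) u =
  (d + d) * (q y z (J Omega) * g x u - q y z x * theta (J u))
  + (d + d + (d + d)) * (k5%:F * (q y z Omega * g x u - q y z (J Omega) * g x (J u))
    + k6%:F * (q y z Omega * g x (J u) + q y z (J Omega) * g x u)
    + k7%:F * (q y z x * theta u - q y z (J x) * theta (J u))
    + k8%:F * (q y z (J x) * theta u + q y z x * theta (J u))).
Proof.
by rewrite [in LHS]/Qform theta_nablaQ thetaJ_nablaQ metric_nablaQr metricJ_nablaQ.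
Qed.

Lemma Qform_Omega y z : q y z Omega =
  (d + d) * (theta (J z) * theta y - g y z * theta (J Omega))
  + (d + d + (d + d)) * (k5%:F * (theta z * theta y - theta (J z) * theta (J y))
    + k6%:F * (theta z * theta (J y) + theta (J z) * theta y)
    + k7%:F * (g y z * theta Omega - g y (J z) * theta (J Omega))
    + k8%:F * (g y (J z) * theta Omega + g y z * theta (J Omega))).
Proof. by rewrite /Qform metric_Omega metric_JOmega. Qed.

Lemma Qform_JOmega y z : q y z (J Omega) =
  (d + d) * (theta (J z) * theta (J y) + g y z * theta Omega)
  + (d + d + (d + d)) * (k5%:F * (theta z * theta (J y) + theta (J z) * theta y)
    + k6%:F * (- theta z * theta y + theta (J z) * theta (J y))
    + k7%:F * (g y z * theta (J Omega) + g y (J z) * theta Omega)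
    + k8%:F * (g y (J z) * theta (J Omega) - g y z * theta Omega)).
Proof.
rewrite /Qform metric_JOmega metricJ2 metric_Omega thetaJ2; ring.
Qed.

Lemma Qform_J x y z : q y z (J x) =
  (d + d) * (theta (J z) * g x (J y) + g y z * theta x)
  + (d + d + (d + d)) * (k5%:F * (theta z * g x (J y) + theta (J z) * g y x)
    + k6%:F * (- theta z * g y x + theta (J z) * g x (J y))
    + k7%:F * (g y z * theta (J x) + g y (J z) * theta x)
    + k8%:F * (g y (J z) * theta (J x) - g y z * theta x)).
Proof.
rewrite /Qform metricJ2 thetaJ2 (metricJC y x); ring.
Qed.

End Difference.

(** * The curvature formulas as polynomial identities *)

Section Formula.
Context (k7 k8 : R).
Notation R' := (curvature4 g (nabla' 0 0 0 0 (- k7) (- k8) k7 k8 D theta Omega)).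
Notation R0 := (curvature4 g (nabla' 0 0 0 0 0 0 0 0 D theta Omega)).
Notation S1 := (tensorS1 k7 D theta Omega).
Notation S2 := (tensorS2 k8 D theta Omega).
Notation S3 := (tensorS3 theta).

Lemma curvature_diff_formula x y z u :
  R' x y z u = R0 x y z u
                + (k7 / n%:R)%:F * psi12 S1 x y z u
                + (k8 / n%:R)%:F * psi12 S2 x y z u
                + (k7 * (4 * k8 - 1) / (2 * n%:R ^+ 2))%:F * psi12 S3 x y z u
                + (k7 * (1 - 2 * k8) / n%:R ^+ 2)%:F * theta (J Omega)
                    * (pi1 x y z u - pi2 x y z u)
                + (2 * k7 * k8 / n%:R ^+ 2)%:F * theta Omega * pi3 x y z u.
Proof.

have n0 : (n%:R : R) != 0 by rewrite pnatr_eq0 -lt0n.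
(* All numerical coefficients become integral polynomials in [d] and the parameters. *)
have e1 a : (a / n%:R)%:F = a%:F * (d + d + (d + d)) by rewrite cfunM natrV1.
have e3 a : (a / n%:R ^+ 2)%:F
    = a%:F * ((d + d + (d + d)) * (d + d + (d + d))) :> Cinf M.
  by rewrite -natrV1 -!cfunM -invfM -expr2.
have e4 a : (a / (2 * n%:R ^+ 2))%:F = a%:F * ((d + d) * (d + d + (d + d))) :> Cinf M.
  rewrite -natrV1 -natrV2 -!cfunM; congr _%:F.
  by rewrite natrM; field.
have e5 (a : R) : (a / (2 * n)%:R)%:F = a%:F * (d + d) by rewrite cfunM natrV2.
have c2 : 2%:F = 1 + 1 :> Cinf M by rewrite -cfun1 -cfunD.
have c4 : 4%:F = 1 + 1 + (1 + 1) :> Cinf M by rewrite -cfun1 -!cfunD; congr _%:F; ring.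
rewrite !pi1E !pi2E /pi3 /psi12 /psi1 /psi2 /tensorS1 /tensorS2 /tensorS3 /gtilde.
rewrite !(e1, e3, e4, e5) !(cfunM, cfunD, cfunN, cfun1, c2, c4).
rewrite !(metricJ2, thetaJ2, nabla1J2).
rewrite !curvature4_nablaQ !Qform_nablaQ !Qform_Omega !Qform_JOmega !Qform_J.
rewrite /dQform /dgJ /dthetaJ /Qform !cfunN !cfun0.
(* Antisymmetrisation also produces the pair (y, x); orienting g and gtilde on it leaves the same
   atoms on both sides. *)
rewrite (metricC y x) (metricJC y x).
ring.
Qed.

Lemma nabla0E : nabla0 D theta Omega = nabla' 0 0 0 0 0 0 0 0 D theta Omega.
Proof.
apply/funext => x; apply/funext => y; rewrite /nabla0 /nabla' /nablaQ.
by rewrite !cfun0 !scale0r !addr0 scaler0 addr0.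
Qed.

Lemma curvature_nabla0_formula x y z u :
  curvature4 g (nabla0 D theta Omega) x y z u = curvature4 g D x y z u
    - ((2 * n)%:R^-1)%:F * psi1 (tensorP D theta Omega) x y z u.
Proof.
rewrite nabla0E !curvature4_nablaQ !Qform_nablaQ !Qform_Omega !Qform_JOmega !Qform_J.
rewrite /dQform /dgJ /dthetaJ /Qform !cfun0 /psi1 /tensorP natrV2.
rewrite (metricC y x) (metricJC y x).
ring.
Qed.

End Formula.

Lemma metric_inj x y : (forall u, g x u = g y u) -> x = y.
Proof.
move=> xy; apply: vfieldP => f; apply: CinfP => p.
apply/eqP; rewrite -subr_eq0; apply/eqP.
have [_ _ nd] := nm_metric M; apply: (nd p (x - y)) => u.
by rewrite metricDl metricNl xy subrr.
Qed.

(** * The terms in lambda_1, ..., lambda_4 and complexity of nabla' *)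

Section LineTerms.
Context (k1 k2 k3 k4 k5 k6 k7 k8 : R).
Local Notation D' := (nabla' k1 k2 k3 k4 k5 k6 k7 k8 D theta Omega).
Local Notation D'' := (nabla' 0 0 0 0 k5 k6 k7 k8 D theta Omega).

Definition line_form (a b : R) x : Cinf M :=
  (n%:R^-1)%:F * (a%:F * theta x + b%:F * theta (J x)).

Lemma nabla'_line x y :
  D' x y = D'' x y + line_form k1 k3 x *: y + line_form k2 k4 x *: J y.
Proof.
apply: vfieldP => f; rewrite /nabla' /nablaQ /line_form !cfun0.
rewrite !(vf_addE, vf_scaleE, vf_oppE).
by ring.
Qed.

Lemma line_formZD a b f x y :
  line_form a b (f *: x + y) = f * line_form a b x + line_form a b y.
Proof. by rewrite /line_form ?linearP /= ?linearP /=; ring. Qed.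

Lemma line_form_closed a b : closed_form (line_form a b).
Proof.
move=> x y; have := ck_closed ck x y; have := ck_closed_star ck x y.
rewrite /dform /line_form /= !(vfZ, vfD) => h1 h2.
(* The zeros are then replaced by the exterior derivatives of theta and theta o J, whose combination
   is the left side. *)
have -> : 0 = (n%:R^-1)%:F * (a%:F * 0 + b%:F * 0) :> Cinf M by ring.
rewrite -{1}h2 -h1; ring.
Qed.

Lemma metric_nabla' x y u : g (D'' x y) u =
  g (D x y) u + Qform d k5%:F k6%:F k7%:F k8%:F x y u.
Proof. by rewrite /nabla' metricDl metric_nablaQ. Qed.

Lemma complex_connection_nabla'0 : complex_connection D''.
Proof.
have [cD1 cD2 cD3] := connD.
split; [split|].
- move=> f x y z; apply: metric_inj => u.
  rewrite [in RHS]metricDl [in RHS]metricZl !metric_nabla' cD1 /Qform !metricE; ring.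
- move=> x y z; apply: metric_inj => u.
  rewrite [in RHS]metricDl !metric_nabla' cD2 /Qform ?linearD /= ?linearD /= !metricE; ring.
- move=> f x y; apply: metric_inj => u.
  rewrite [in RHS]metricDl [in RHS]metricZl [in RHS]metricZl !metric_nabla' cD3 /Qform.
  rewrite ?linearZ /= ?linearZ /= !metricE; ring.
(* The brackets with coefficients lambda_5, ..., lambda_8 commute with J, and the 1/(2n)-term of Q
   compensates nabla J as given by the W1 condition. *)
move=> x y; apply: metric_inj => u.
rewrite (metricJl (D'' x y)) !metric_nabla' connJ metricDl tensorFE metricJl.
rewrite /Qform !(metricJ2, thetaJ2); ring.
Qed.

End LineTerms.

Section LineConnection.
Context (D1 : vfield M -> vfield M -> vfield M) (a b : vfield M -> Cinf M).
Hypothesis cD1 : complex_connection D1.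
Hypothesis aZD : forall f x y, a (f *: x + y) = f * a x + a y.
Hypothesis bZD : forall f x y, b (f *: x + y) = f * b x + b y.
Local Notation D2 := (fun x y => D1 x y + a x *: y + b x *: J y).

Lemma complex_connection_line : complex_connection D2.
Proof.
have [[c1 c2 c3] cJ] := cD1.
split; [split|] => [f x y z|x y z|f x y|x y].
- by apply: vfieldP => h; rewrite c1 aZD bZD !(vf_addE, vf_scaleE); ring.
- by apply: vfieldP => h; rewrite c2 !linearD /= ?(vf_addE, vf_scaleE); ring.
- by apply: vfieldP => h; rewrite c3 !linearZ /= ?(vf_addE, vf_scaleE); ring.
- by rewrite cJ !linearD /= !linearZ.
Qed.

(** The endomorphisms id and J are parallel for [D1] and commute, so the curvature changes by da id
    + db J, which is zero. *)
Lemma curvature_line : closed_form a -> closed_form b ->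
  forall x y z, curvature D2 x y z = curvature D1 x y z.
Proof.
have [[c1 c2 c3] cJ] := cD1.
move=> ca cb x y z; apply: vfieldP => h.
have {}ca := ca x y; have {}cb := cb x y.
rewrite /dform in ca cb.
have aE : a (bracket x y) = x (a y) - y (a x).
  by apply/eqP; rewrite eq_sym -subr_eq0 ca.
have bE : b (bracket x y) = x (b y) - y (b x).
  by apply/eqP; rewrite eq_sym -subr_eq0 cb.
rewrite /curvature !c2 !c3 !cJ !linearD /= !linearZ /= !nm_J2 aE bE.
rewrite !(vf_addE, vf_scaleE, vf_oppE); ring.
Qed.
End LineConnection.

Section General.
Context (k1 k2 k3 k4 k5 k6 k7 k8 : R).
Local Notation D' := (nabla' k1 k2 k3 k4 k5 k6 k7 k8 D theta Omega).
Local Notation D'' := (nabla' 0 0 0 0 k5 k6 k7 k8 D theta Omega).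

Lemma nabla'_lineE : D' = fun x y =>
  D'' x y + line_form k1 k3 x *: y + line_form k2 k4 x *: J y.
Proof. by apply/funext => x; apply/funext => y; exact: nabla'_line. Qed.

Lemma complex_connection_nabla' : complex_connection D'.
Proof.
rewrite nabla'_lineE; apply: complex_connection_line.
- exact: complex_connection_nabla'0.
- exact: line_formZD.
- exact: line_formZD.
Qed.

Lemma curvature4_nabla' x y z u : curvature4 g D' x y z u = curvature4 g D'' x y z u.
Proof.
rewrite /curvature4 nabla'_lineE curvature_line //.
- exact: complex_connection_nabla'0.
- exact: line_form_closed.
- exact: line_form_closed.
Qed.
End General.

(** * Symmetries of the curvature tensors *)

Lemma bracketC x y : bracket x y = - bracket y x.
Proof. by apply: vfieldP => f /=; rewrite opprB. Qed.

Lemma curvature_anti (D1 : vfield M -> vfield M -> vfield M) : connection D1 ->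
  forall x y z, curvature D1 x y z = - curvature D1 y x z.
Proof.
move=> [c1 _ _] x y z; rewrite /curvature (bracketC x y).
have c0 w : D1 0 w = 0.
  have := c1 1 0 0 w; rewrite !scale1r addr0 => h.
  by apply: (addrI (D1 0 w)); rewrite addr0 -h.
have -> : D1 (- bracket y x) z = - D1 (bracket y x) z.
  by have := c1 (-1) (bracket y x) 0 z; rewrite !scaleN1r c0 !addr0.
by rewrite !opprD !opprK addrAC addrC addrA.
Qed.

Lemma curvature_complex (D1 : vfield M -> vfield M -> vfield M) :
  complex_connection D1 -> forall x y z u, curvature4 g D1 x y (J z) (J u) = - curvature4 g D1 x y z u.
Proof.
by move=> [_ cJ] x y z u; rewrite /curvature4 /curvature !cJ -!linearB nm_norden.
Qed.

Lemma curvature_levi_civita : curvature_like (curvature4 g D).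
Proof.
split=> [x y z u|x y z u|x y z u].
- by rewrite /curvature4 (curvature_anti connD) metricNl.
(* The bracket is applied to the function [g z u] in two ways: by metricity, and as a commutator of
   derivations. *)
- have h : bracket x y (g z u) = g (D (bracket x y) z) u + g z (D (bracket x y) u).
    exact: vf_metric.
  have bE f : bracket x y f = x (y f) - y (x f) by [].
  rewrite bE !vf_metric !vfD !vf_metric in h.
  rewrite /curvature4 /curvature !metricDl !metricNl !(metricC _ z).
  apply: (addIr (g (D (bracket x y) z) u + g z (D (bracket x y) u))).
  rewrite -[in RHS]h; ring.
(* Torsion-freeness reduces the cyclic sum to double brackets; evaluated on a function, they cancel
   by the Jacobi identity. *)
have tors a b : D a b = D b a + bracket a b by rewrite bracketE addrC subrK.
rewrite /curvature4 -!metricDl; apply: etrans (metric0l u); congr (g _ u).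
apply: vfieldP => f; rewrite /curvature.
rewrite (tors y z) (tors z x) (tors x y) !connDr.
rewrite (tors (bracket y z) x) (tors (bracket z x) y) (tors (bracket x y) z).
rewrite !(vf_addE, vf_oppE) /= !vfB; ring.
Qed.

Local Notation tensor4 := (vfield M -> vfield M -> vfield M -> vfield M -> Cinf M).

Lemma curvature_likeD (L K : tensor4) : curvature_like L -> curvature_like K ->
  curvature_like (fun x y z u => L x y z u + K x y z u).
Proof.
move=> [L1 L2 L3] [K1 K2 K3]; split=> x y z u.
- by rewrite L1 K1 opprD.
- by rewrite L2 K2 opprD.
- transitivity ((L x y z u + L y z x u + L z x y u)
    + (K x y z u + K y z x u + K z x y u)); first by ring.
  by rewrite L3 K3 addr0.
Qed.

Lemma curvature_likeZ f (L : tensor4) : curvature_like L ->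
  curvature_like (fun x y z u => f * L x y z u).
Proof.
move=> [L1 L2 L3]; split=> x y z u.
- by rewrite L1 mulrN.
- by rewrite L2 mulrN.
- by rewrite -!mulrDr L3 mulr0.
Qed.

Lemma eq_curvature_like (L K : tensor4) : (forall x y z u, L x y z u = K x y z u) ->
  curvature_like L -> curvature_like K.
Proof.
move=> LK [L1 L2 L3]; split=> x y z u; rewrite -!LK; [exact: L1|exact: L2|exact: L3].
Qed.

(** The first condition makes [psi1 S] curvature-like, the second [psi2 S]. *)
Definition Jsymmetric (S : vfield M -> vfield M -> Cinf M) :=
  (forall x y, S x y = S y x) /\ (forall x y, S x (J y) = S y (J x)).

Lemma curvature_like_psi1 S : (forall x y, S x y = S y x) -> curvature_like (psi1 S).
Proof.
move=> SC; split=> x y z u; rewrite /psi1.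
- by ring.
- by ring.
- rewrite (metricC y x) (metricC z x) (metricC z y) (SC y x) (SC z x) (SC z y); ring.
Qed.

Lemma curvature_like_psi2 S : (forall x y, S x (J y) = S y (J x)) ->
  curvature_like (psi2 S).
Proof.
move=> SC; split=> x y z u; rewrite /psi2.
- by ring.
- by ring.
- rewrite (metricJC y x) (metricJC z x) (metricJC z y) (SC y x) (SC z x) (SC z y); ring.
Qed.

Lemma curvature_like_psi12 S : Jsymmetric S -> curvature_like (psi12 S).
Proof.
move=> [S1 S2]; have := curvature_likeD (curvature_like_psi1 S1)
  (curvature_likeZ (-1) (curvature_like_psi2 S2)).
by apply: eq_curvature_like => x y z u; rewrite mulN1r.
Qed.

(** Closedness of theta gives the first symmetry of the nabla theta term, closedness of theta o J
    the second; for [tensorS2] the roles are exchanged. *)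
Lemma Jsymmetric_tensorS1 a : Jsymmetric (tensorS1 a D theta Omega).
Proof.
split=> x y; rewrite /tensorS1.
- rewrite (nabla1C y x) (metricC y x) (metricJC y x); ring.
- rewrite !metricJ2 !thetaJ2 (nabla1JC y x) (metricC y x) (metricJC y x); ring.
Qed.

Lemma Jsymmetric_tensorS2 a : Jsymmetric (tensorS2 a D theta Omega).
Proof.
split=> x y; rewrite /tensorS2.
- rewrite (nabla1JC y x) (metricC y x) (metricJC y x); ring.
- rewrite !metricJ2 !thetaJ2 !nabla1J2 (nabla1C y x) (metricC y x) (metricJC y x); ring.
Qed.

Lemma Jsymmetric_tensorS3 : Jsymmetric (tensorS3 theta).
Proof.
split=> x y; rewrite /tensorS3 ?thetaJ2; ring.
Qed.

Lemma tensorPC x y : tensorP D theta Omega x y = tensorP D theta Omega y x.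
Proof.
rewrite /tensorP (nabla1JC y x) (metricC y x) (metricJC y x); ring.
Qed.

Lemma curvature_like_nabla0 : curvature_like (curvature4 g (nabla0 D theta Omega)).
Proof.
have := curvature_likeD curvature_levi_civita
  (curvature_likeZ (- ((2 * n)%:R^-1)%:F) (curvature_like_psi1 tensorPC)).
by apply: eq_curvature_like => x y z u; rewrite curvature_nabla0_formula mulNr.
Qed.

Lemma kahler_nabla' k1 k2 k3 k4 k7 k8 : kahler_tensor (curvature4 g
  (nabla' k1 k2 k3 k4 (- k7) (- k8) k7 k8 D theta Omega)).
Proof.
split; last exact/curvature_complex/complex_connection_nabla'.
have h12 S f : Jsymmetric S -> curvature_like (fun x y z u => f * psi12 S x y z u).
  by move=> /curvature_like_psi12; exact: curvature_likeZ.
have hpi : curvature_like (fun x y z u => pi1 x y z u - pi2 x y z u).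
  have gJ : Jsymmetric g by split; [exact: metricC|exact: metricJC].
  have := h12 _ (2^-1)%:F gJ; apply: eq_curvature_like => x y z u.
  by rewrite /pi1 /pi2 /psi12 mulrBr.
have hpi3 : curvature_like (@pi3 R n M).
  have := curvature_likeZ (-1) (curvature_like_psi1 metricJC).
  by apply: eq_curvature_like => x y z u; rewrite mulN1r.
have := curvature_likeD (curvature_likeD (curvature_likeD (curvature_likeD (curvature_likeD
  curvature_like_nabla0 (h12 _ (k7 / n%:R)%:F (Jsymmetric_tensorS1 k7)))
    (h12 _ (k8 / n%:R)%:F (Jsymmetric_tensorS2 k8)))
    (h12 _ (k7 * (4 * k8 - 1) / (2 * n%:R ^+ 2))%:F Jsymmetric_tensorS3))
    (curvature_likeZ ((k7 * (1 - 2 * k8) / n%:R ^+ 2)%:F * theta (J Omega)) hpi))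
    (curvature_likeZ ((2 * k7 * k8 / n%:R ^+ 2)%:F * theta Omega) hpi3).
apply: eq_curvature_like => x y z u.
by rewrite curvature4_nabla' curvature_diff_formula nabla0E.
Qed.

(** * The failure of antisymmetry of R' where theta vanishes *)

Section VanishingPoint.
Context (p : M).
Hypothesis theta_p : forall v, theta v p = 0.

Lemma Qform_vanish a k5 k6 k7 k8 x y u : Qform a k5 k6 k7 k8 x y u p = 0.
Proof.
by rewrite /Qform !(Cinf_addE, Cinf_mulE, Cinf_oppE) !theta_p; ring.
Qed.

Lemma dgJ_vanish a x y z : dgJ a x y z p = 0.
Proof. by rewrite /dgJ !(Cinf_addE, Cinf_mulE) !theta_p; ring. Qed.

Lemma dthetaJ_vanish a x y : dthetaJ a x y p = N x (J y) p.
Proof.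
rewrite /dthetaJ; move: (N x (J y)) => f.
by rewrite !(Cinf_addE, Cinf_mulE) !theta_p; ring.
Qed.

Lemma dQform_vanish a k5 k6 k7 k8 x y z u : dQform a k5 k6 k7 k8 x y z u p =
  (a p + a p) * (N x (J z) p * g y u p - g y z p * N x (J u) p)
  + (a p + a p + (a p + a p)) *
   (k5 p * (N x z p * g y u p - N x (J z) p * g y (J u) p)
    + k6 p * (N x z p * g y (J u) p + N x (J z) p * g y u p)
    + k7 p * (g y z p * N x u p - g y (J z) p * N x (J u) p)
    + k8 p * (g y (J z) p * N x u p + g y z p * N x (J u) p)).
Proof.
rewrite /dQform -!(dthetaJ_vanish a).
move: (dgJ a x y u) (dgJ a x y z) (dgJ_vanish a x y u) (dgJ_vanish a x y z).
move: (dthetaJ a x z) (dthetaJ a x u) (N x z) (N x u) => t1 t2 f1 f2 g1 g2 g1p g2p.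
by rewrite !(Cinf_addE, Cinf_mulE, Cinf_oppE) g1p g2p !theta_p; ring.
Qed.

(** The curvature of D and the 1/(2n)-term are antisymmetric in z, u, and the terms quadratic in
    theta vanish at p. Symmetrisation gives lambda_5 and lambda_7 the same coefficient, and likewise
    lambda_6 and lambda_8. If N_c and g_c are the complex bilinear forms with real parts N and g,
    the two coefficients are the real part and minus the imaginary part of N_c(x,z) g_c(y,u) +
    N_c(x,u) g_c(y,z), minus the same with x and y exchanged. *)
Lemma curvature_defect k1 k2 k3 k4 k5 k6 k7 k8 x y z u :
  let R' := curvature4 g (nabla' k1 k2 k3 k4 k5 k6 k7 k8 D theta Omega) in
  R' x y z u p + R' x y u z p = (n%:R^-1) *
   ((k5 + k7) * (N x z p * g y u p + N x u p * g y z p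
       - N x (J z) p * g y (J u) p - N x (J u) p * g y (J z) p
     - (N y z p * g x u p + N y u p * g x z p
       - N y (J z) p * g x (J u) p - N y (J u) p * g x (J z) p))
   + (k6 + k8) * (N x z p * g y (J u) p + N x (J z) p * g y u p
       + N x u p * g y (J z) p + N x (J u) p * g y z p
     - (N y z p * g x (J u) p + N y (J z) p * g x u p
       + N y u p * g x (J z) p + N y (J u) p * g x z p))).
Proof.
have dR w v : curvature4 g (nabla' k1 k2 k3 k4 k5 k6 k7 k8 D theta Omega) x y w v p =
    curvature4 g D x y w v p
    + dQform d k5%:F k6%:F k7%:F k8%:F x y w v p
    - dQform d k5%:F k6%:F k7%:F k8%:F y x w v p.
  rewrite curvature4_nabla' curvature4_nablaQ.
  set Q := nablaQ _ _ _ _ _ _ _ _ _ _.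
  have := Qform_vanish d k5%:F k6%:F k7%:F k8%:F x (Q y w) v.
  have := Qform_vanish d k5%:F k6%:F k7%:F k8%:F y (Q x w) v.
  move: (Qform _ _ _ _ _ _ _ _) (Qform _ _ _ _ _ _ _ _) => q1 q2 q1p q2p.
  by rewrite -[LHS]/(_ p + _ p - _ p + q1 p - q2 p) q1p q2p subr0 addr0.
move=> R'; rewrite /R' !dR !dQform_vanish {R'}.
have [_ /(_ x y z u) -> _] := curvature_levi_civita; rewrite Cinf_oppE.
have cfunE a : (a%:F : Cinf M) p = a by [].
have n0 : (n%:R : R) != 0 by rewrite pnatr_eq0 -lt0n.
have -> : n%:R^-1 = (4 * n)%:R^-1 + (4 * n)%:R^-1 + ((4 * n)%:R^-1 + (4 * n)%:R^-1) :> R.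
  by rewrite natrM; field.
rewrite !cfunE; ring.
Qed.
End VanishingPoint.

End ConformalKahler.

(** * Vector fields on R^m in coordinates *)

Section EuclideanFields.
Context (R : realType) (m : nat).
Local Notation E := 'rV[R]_m.
Local Notation smoothT := (smooth_on (@setT E)).
Local Notation M := (row_manifold R m).
Implicit Types (f : Cinf M) (x y : vfield M).

Lemma row_smoothP (f : E -> R) : smooth (M := M) f <-> smoothT f.
Proof.
rewrite /smooth; split=> [/(_ (row_chart R m) erefl)|sf c ->];
  by rewrite /chart_img /= image_id.
Qed.

Definition row_Cinf (f : E -> R) (sf : smoothT f) : Cinf M :=
  @MkCinf _ _ M f (asboolT (iffRL (row_smoothP f) sf)).

Lemma Cinf_smoothT (f : Cinf M) : smoothT f.
Proof. by case: f => f /= /asboolP/row_smoothP. Qed.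

Definition coordf (j : 'I_m) : Cinf M := row_Cinf (smoothT_coord R j).

Definition partialf (i : 'I_m) f : Cinf M :=
  row_Cinf (smoothT_partial i (Cinf_smoothT f)).

Lemma partialf_linear i (a : R) f g :
  partialf i (a%:F * f + g) = a%:F * partialf i f + partialf i g.
Proof.
apply: CinfP => p.
have df := smoothT_is_derive i p (Cinf_smoothT f).
have dg := smoothT_is_derive i p (Cinf_smoothT g).
have := is_deriveD (is_deriveZ a df) dg.
by case.
Qed.

Lemma partialf_leibniz i f g :
  partialf i (f * g) = partialf i f * g + f * partialf i g.
Proof.
apply: CinfP => p.
have df := smoothT_is_derive i p (Cinf_smoothT f).
have dg := smoothT_is_derive i p (Cinf_smoothT g).
have [_ /= h] := is_deriveM df dg.
rewrite [LHS]h [LHS]addrC; congr (_ + _).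
exact: mulrC.
Qed.

Definition dpart (i : 'I_m) : vfield M :=
  @MkVfield _ _ _ (partialf i) (partialf_linear i) (partialf_leibniz i).

Lemma dpart_coord i j : dpart i (coordf j) = (i == j)%:R%:F.
Proof. by apply: CinfP => p; case: (is_derive_coord i j p). Qed.

(** Hadamard's lemma at p writes f as f(p) plus the sum of (X_i - p_i) h_i. The Leibniz rule leaves
    x(X_i) h_i at p, because X_i - p_i vanishes there, and h_i(p) is the i-th partial derivative. *)
Lemma vfieldE x f : x f = \sum_i x (coordf i) * dpart i f.
Proof.
apply: CinfP => p; rewrite Cinf_sumE.
have [h [sh hp fE]] := Hadamard p (Cinf_smoothT f).
pose H i := row_Cinf (sh i).
have fE' : f = (f p)%:F + \sum_i (coordf i - (p 0 i)%:F) * H i.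
  by apply: CinfP => q; rewrite Cinf_addE Cinf_sumE [LHS]fE.
rewrite [in LHS]fE' vfD vf_cfun add0r vf_sum Cinf_sumE; apply: eq_bigr => i _.
rewrite vf_leibniz vfB vf_cfun subr0 Cinf_addE !Cinf_mulE.
rewrite [X in _ + X * _](_ : _ = 0); last exact: subrr.
rewrite mul0r addr0; congr (_ * _).
exact: hp.
Qed.

Lemma is_derive_expR_comp (f : E -> R) i (v : E) : smoothT f ->
  is_derive v (delta_mx 0 i) (expR \o f) (expR (f v) * partial i f v).
Proof.
move=> sf; have ev : v = 0 *: delta_mx 0 i + v by rewrite scale0r add0r.
rewrite {1}ev; apply: (iffRL (is_derive_line _ _ _ _ _)).
have := smoothT_is_derive i v sf; rewrite {1}ev => /is_derive_line df.
have := @is_derive1_comp R expR (fun h => f (h *: delta_mx 0 i + v)) 0 _ _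
  (is_derive_expR _) df.
by rewrite scale0r add0r.
Qed.

Lemma smoothT_expR (f : E -> R) : smoothT f -> smoothT (expR \o f).
Proof.
have cexp (g : E -> R) : smoothT g ->
    forall v, [set: E] v -> {for v, continuous (expR \o g)}.
  move=> sg v _; apply: continuous_comp; first exact: smoothT_continuous.
  exact: continuous_expR.
move=> sf k; elim: k => [|k IH]; split=> //; try exact: cexp.
move=> i; split=> [v _|]; first by case: (is_derive_expR_comp i v sf).
apply: (@eq_Ck_on _ _ _ openT _ ((expR \o f) * partial i f)).
  by move=> v _; apply/esym; case: (is_derive_expR_comp i v sf).
by apply: (Ck_onM openT IH); exact: smoothT_partial.
Qed.

Definition expf (f : Cinf M) : Cinf M := row_Cinf (smoothT_expR (Cinf_smoothT f)).

(** An abstract derivation obeys the chain rule because it is a combination of partial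
    derivatives. *)
Lemma vf_expf x f : x (expf f) = expf f * x f.
Proof.
rewrite vfieldE (vfieldE x f) mulr_sumr; apply: eq_bigr => i _.
rewrite mulrCA; congr (_ * _); apply: CinfP => p.
by case: (is_derive_expR_comp i p (Cinf_smoothT f)).
Qed.

Lemma expfN f : expf f * expf (- f) = 1.
Proof. by apply: CinfP => p; rewrite Cinf_mulE /= -expRD subrr expR0. Qed.

Lemma expf_gt0 f p : 0 < expf f p. Proof. exact: expR_gt0. Qed.

Lemma vfield_eqP x y : (forall k, x (coordf k) = y (coordf k)) -> x = y.
Proof.
move=> xy; apply: vfieldP => f; rewrite vfieldE (vfieldE y).
by apply: eq_bigr => k _; rewrite xy.
Qed.

Definition field_of (a : 'I_m -> Cinf M) : vfield M := \sum_k a k *: dpart k.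

Lemma field_ofE a f : field_of a f = \sum_k a k * dpart k f.
Proof. by rewrite vf_sumE. Qed.

Lemma field_of_coord a k : field_of a (coordf k) = a k.
Proof.
rewrite field_ofE (bigD1 k) // big1 => [|i /andP[_ ik]].
  by rewrite [LHS]addr0 dpart_coord eqxx cfun1 mulr1.
by rewrite dpart_coord (negbTE ik) cfun0 mulr0.
Qed.

End EuclideanFields.
(** * A conformally flat example on C^n *)

(* The coordinates i < n and i + n of R^(2n) are Re z_i and Im z_i. *)
Section Example.
Context (R : realType) (n : nat) (n1 : (1 < n)%N).
Local Notation M := (row_manifold R (2 * n)).
Local Notation VF := (vfield M).
Local Notation X := (@coordf R (2 * n)).
Local Notation pd := (@dpart R (2 * n)).
Implicit Types (f h : Cinf M) (x y z : VF) (i j k : 'I_(2 * n)).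

(** Exchanges the indices of Re z_i and Im z_i. The default of [insubd] is never taken, since the
    shifted index stays below [2 * n]. *)
Definition conj_ord i : 'I_(2 * n) := insubd i (if (i < n)%N then i + n else i - n)%N.

Lemma conj_ordE i : conj_ord i = (if (i < n)%N then i + n else i - n)%N :> nat.
Proof.
rewrite /conj_ord val_insubd; have := ltn_ord i.
by case: ifP => //; case: ifP; lia.
Qed.

Lemma conj_ordK : involutive conj_ord.
Proof.
move=> i; apply: val_inj; rewrite /= !conj_ordE; have := ltn_ord i.
by case: (ltnP i n) => h; case: ifP; lia.
Qed.

(** The sign of each coordinate in Re(sum_i dz_i^2). *)
Definition sgn i : R := if (i < n)%N then 1 else -1.

Lemma sgn_conj i : sgn (conj_ord i) = - sgn i.
Proof.
rewrite /sgn conj_ordE; have := ltn_ord i.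
by case: (ltnP i n) => h hi; case: ifP; rewrite ?opprK //; lia.
Qed.

Lemma sgn2 i : sgn i * sgn i = 1.
Proof. by rewrite /sgn; case: ifP; rewrite ?mulrNN mulr1. Qed.

Lemma sgn2F i : (sgn i)%:F * (sgn i)%:F = 1 :> Cinf M.
Proof. by rewrite -cfunM sgn2 cfun1. Qed.

(** Multiplication by the imaginary unit on C^n. *)
Definition stdJ x : VF := field_of (fun k => - (sgn k)%:F * x (X (conj_ord k))).

Lemma stdJ_coord x k : stdJ x (X k) = - (sgn k)%:F * x (X (conj_ord k)).
Proof. exact: field_of_coord. Qed.

Lemma stdJ_linear : linear stdJ.
Proof.
move=> f x y; apply: vfield_eqP => k.
rewrite vf_addE vf_scaleE !stdJ_coord vf_addE vf_scaleE; ring.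
Qed.

HB.instance Definition _ := GRing.isLinear.Build (Cinf M) VF VF *:%R stdJ stdJ_linear.

Lemma stdJ2 x : stdJ (stdJ x) = - x.
Proof.
apply: vfield_eqP => k; rewrite !stdJ_coord conj_ordK sgn_conj cfunN vf_oppE.
transitivity (- (((sgn k)%:F * (sgn k)%:F) * x (X k))); first by ring.
by rewrite sgn2F mul1r.
Qed.

Definition flat_metric x y : Cinf M := \sum_k (sgn k)%:F * x (X k) * y (X k).

Lemma flat_metricDl f x y z :
  flat_metric (f *: x + y) z = f * flat_metric x z + flat_metric y z.
Proof.
rewrite /flat_metric mulr_sumr -big_split; apply: eq_bigr => k _ /=.
ring.
Qed.

Lemma flat_metricC x y : flat_metric x y = flat_metric y x.
Proof. by apply: eq_bigr => k _; ring. Qed.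

Lemma flat_metricJ x y : flat_metric (stdJ x) (stdJ y) = - flat_metric x y.
Proof.
rewrite /flat_metric (reindex_inj (inv_inj conj_ordK)) /= -sumrN.
apply: eq_bigr => k _; rewrite !stdJ_coord conj_ordK !sgn_conj !cfunN.
transitivity (- ((sgn k)%:F * (sgn k)%:F * ((sgn k)%:F * x (X k) * y (X k)))).
  by ring.
by rewrite sgn2F mul1r.
Qed.

Lemma flat_metricJl x y : flat_metric (stdJ x) y = flat_metric x (stdJ y).
Proof.
rewrite /flat_metric (reindex_inj (inv_inj conj_ordK)) /=.
apply: eq_bigr => k _; rewrite !stdJ_coord conj_ordK !sgn_conj !cfunN; ring.
Qed.

Lemma flat_metric_dpart x k : flat_metric x (pd k) = (sgn k)%:F * x (X k).
Proof.
rewrite /flat_metric (bigD1 k) // big1 => [|i /andP[_ ik]].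
  by rewrite [LHS]addr0 dpart_coord eqxx cfun1 mulr1.
by rewrite dpart_coord eq_sym (negbTE ik) cfun0 mulr0.
Qed.

(** * The conformal metric with factor e^(2u) *)

Section Conformal.
Context (u : Cinf M).

Definition conf_metric x y : Cinf M := expf (u + u) * flat_metric x y.

Lemma conf_metric_pseudo_riemannian : pseudo_riemannian conf_metric.
Proof.
split=> [f x y z|x y|p x xp f].
- by rewrite /conf_metric flat_metricDl; ring.
- by rewrite /conf_metric flat_metricC.
(* Pairing with the k-th coordinate field recovers x(X_k) up to a nonzero factor. *)
suff x0 k : x (X k) p = 0.
  by rewrite vfieldE Cinf_sumE big1 // => k _; rewrite Cinf_mulE x0 mul0r.
have := xp (pd k); rewrite Cinf_mulE => /eqP.
rewrite mulf_eq0 gt_eqF ?expf_gt0 //= => /eqP.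
rewrite flat_metric_dpart Cinf_mulE => /eqP.
rewrite mulf_eq0 => /orP[|/eqP //].
rewrite -[X in X == 0]/(sgn k) => /eqP s0.
by have := sgn2 k; rewrite s0 mulr0 => /esym/eqP; rewrite oner_eq0.
Qed.

Lemma conf_metricJ x y : conf_metric (stdJ x) (stdJ y) = - conf_metric x y.
Proof. by rewrite /conf_metric flat_metricJ mulrN. Qed.

Definition conf_norden : norden_manifold R n :=
  @NordenManifold R n M stdJ conf_metric stdJ2 conf_metric_pseudo_riemannian conf_metricJ.

(** The classical formula for a conformal change: the flat derivative of y along x, plus x(u) y +
    y(u) x - g_0(x,y) grad u, with g_0 the flat metric. *)
Definition conf_conn x y : VF := field_of (fun k =>
  x (y (X k)) + x u * y (X k) + y u * x (X k)
  - flat_metric x y * (sgn k)%:F * pd k u).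

Lemma conf_conn_coord x y k : conf_conn x y (X k) =
  x (y (X k)) + x u * y (X k) + y u * x (X k)
  - flat_metric x y * (sgn k)%:F * pd k u.
Proof. exact: field_of_coord. Qed.

Lemma flat_metricDr f x y z :
  flat_metric z (f *: x + y) = f * flat_metric z x + flat_metric z y.
Proof. by rewrite !(flat_metricC z) flat_metricDl. Qed.

Lemma flat_metric0r z : flat_metric z 0 = 0.
Proof. by apply: big1 => k _; rewrite mulr0. Qed.

Lemma flat_metricAr x y z :
  flat_metric z (x + y) = flat_metric z x + flat_metric z y.
Proof. by rewrite -[x in LHS]scale1r flat_metricDr mul1r. Qed.

Lemma flat_metricZr f x z : flat_metric z (f *: x) = f * flat_metric z x.
Proof. by rewrite -[_ *: _]addr0 flat_metricDr flat_metric0r addr0. Qed.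

Lemma connection_conf_conn : connection conf_conn.
Proof.
split=> [f x y z|x y z|f x y]; apply: vfield_eqP => k.
- rewrite vf_addE vf_scaleE !conf_conn_coord flat_metricDl !(vf_addE, vf_scaleE); ring.
- by rewrite vf_addE !conf_conn_coord flat_metricAr !vf_addE vfD; ring.
- by rewrite vf_addE !vf_scaleE !conf_conn_coord flat_metricZr !vf_scaleE vf_leibniz; ring.
Qed.

Lemma flat_metric_conf_conn x y z : flat_metric (conf_conn x y) z =
  \sum_k (sgn k)%:F * x (y (X k)) * z (X k)
  + x u * flat_metric y z + y u * flat_metric x z - z u * flat_metric x y.
Proof.
rewrite [z u]vfieldE mulr_suml !mulr_sumr -!big_split -sumrB.
apply: eq_bigr => k _; rewrite conf_conn_coord.
transitivity ((sgn k)%:F * x (y (X k)) * z (X k)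
  + x u * ((sgn k)%:F * y (X k) * z (X k)) + y u * ((sgn k)%:F * x (X k) * z (X k))
  - ((sgn k)%:F * (sgn k)%:F) * (z (X k) * pd k u * flat_metric x y)).
  by ring.
by rewrite sgn2F mul1r.
Qed.

Lemma levi_civita_conf : levi_civita conf_metric conf_conn.
Proof.
split; first exact: connection_conf_conn.
- move=> x y; apply: vfield_eqP => k.
  rewrite vf_addE vf_oppE !conf_conn_coord (flat_metricC y x) /=; ring.
move=> x y z; rewrite /conf_metric vf_leibniz vf_expf vfD.
rewrite (flat_metricC y (conf_conn x z)) !flat_metric_conf_conn.
rewrite (flat_metricC z y).
have -> : x (flat_metric y z) = \sum_k (sgn k)%:F * x (y (X k)) * z (X k)
    + \sum_k (sgn k)%:F * x (z (X k)) * y (X k).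
  rewrite vf_sum -big_split; apply: eq_bigr => k _ /=.
  rewrite !vf_leibniz vf_cfun; ring.
ring.
Qed.

Definition grad : VF := field_of (fun k => (sgn k)%:F * pd k u).
(** This is J applied to [grad]: the sign in J cancels against [sgn (conj_ord k)] and [sgn k]. *)
Definition Jgrad : VF := field_of (fun k => pd (conj_ord k) u).

Lemma flat_metric_grad z : flat_metric grad z = z u.
Proof.
rewrite [RHS]vfieldE; apply: eq_bigr => k _; rewrite field_of_coord.
by rewrite mulrA sgn2F mul1r mulrC.
Qed.

Lemma flat_metric_Jgrad z : flat_metric Jgrad z = stdJ z u.
Proof.
rewrite [RHS]vfieldE [RHS](reindex_inj (inv_inj conj_ordK)).
apply: eq_bigr => k _; rewrite field_of_coord stdJ_coord conj_ordK sgn_conj cfunN.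
ring.
Qed.

(** J has constant coefficients, so only the terms containing du contribute. *)
Lemma conf_conn_stdJ x y : conf_conn x (stdJ y) - stdJ (conf_conn x y) =
  stdJ y u *: x - y u *: stdJ x - flat_metric x (stdJ y) *: grad
  + flat_metric x y *: Jgrad.
Proof.
apply: vfield_eqP => k.
rewrite !(vf_addE, vf_oppE, vf_scaleE) !conf_conn_coord !stdJ_coord !conf_conn_coord.
rewrite !field_of_coord sgn_conj cfunN vf_leibniz vfN vf_cfun.
set a := pd (conj_ord k) u; set b := pd k u.
transitivity (stdJ y u * x (X k) - y u * (- (sgn k)%:F * x (X (conj_ord k)))
  - flat_metric x (stdJ y) * ((sgn k)%:F * b)
  + (sgn k)%:F * (sgn k)%:F * (flat_metric x y * a)).
  by ring.
by rewrite sgn2F mul1r.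
Qed.

Lemma conf_tensorF x y z : @tensorF R n conf_norden conf_conn x y z =
  expf (u + u) * (stdJ y u * flat_metric x z - y u * flat_metric x (stdJ z)
    - z u * flat_metric x (stdJ y) + stdJ z u * flat_metric x y).
Proof.
rewrite /tensorF -[LHS]/(expf (u + u)
  * flat_metric (conf_conn x (stdJ y) - stdJ (conf_conn x y)) z).
rewrite conf_conn_stdJ (flat_metricC _ z) -!scaleNr !(flat_metricAr, flat_metricZr).
rewrite !(flat_metricC z) flat_metric_grad flat_metric_Jgrad flat_metricJl; ring.
Qed.

(** With theta = 2n du o J, the form theta o J = -2n du is exact for every u, while theta is closed
    precisely when u is pluriharmonic. *)
Definition conf_theta x : Cinf M := (2 * n)%:R%:F * stdJ x u.

Lemma conf_theta_linear : GRing.linear_for *%R conf_theta.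
Proof.
by move=> f x y; rewrite /conf_theta linearP vf_addE vf_scaleE; ring.
Qed.

HB.instance Definition _ := GRing.isLinear.Build (Cinf M) VF (Cinf M) *%R conf_theta
  conf_theta_linear.

Definition conf_Omega : VF := ((2 * n)%:R%:F * expf (- (u + u))) *: Jgrad.

Lemma conf_thetaE x : conf_theta x = conf_metric x conf_Omega.
Proof.
rewrite /conf_metric flat_metricZr (flat_metricC x) flat_metric_Jgrad.
rewrite mulrA mulrCA expfN mulr1 //.
Qed.

Lemma natr2nV : ((2 * n)%:R^-1)%:F * (2 * n)%:R%:F = 1 :> Cinf M.
Proof.
rewrite -cfunM -cfun1 mulVf // pnatr_eq0; lia.
Qed.

Lemma conf_W1 : @W1 R n conf_norden conf_conn conf_theta.
Proof.
move=> x y z; rewrite conf_tensorF /= /conf_theta !stdJ2 !vf_oppE.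
transitivity (((2 * n)%:R^-1)%:F * (2 * n)%:R%:F * (expf (u + u)
    * (stdJ y u * flat_metric x z - y u * flat_metric x (stdJ z)
      - z u * flat_metric x (stdJ y) + stdJ z u * flat_metric x y))).
  by rewrite natr2nV mul1r.
rewrite /conf_metric; ring.
Qed.

Local Notation F := (@tensorF R n conf_norden conf_conn).

Lemma conf_tensorF_linearl f x1 x2 y z : F (f *: x1 + x2) y z = f * F x1 y z + F x2 y z.
Proof. by rewrite !conf_tensorF !flat_metricDl; ring. Qed.

Lemma conf_tensorF_linearr f x y1 y2 z : F x (f *: y1 + y2) z = f * F x y1 z + F x y2 z.
Proof.
by rewrite !conf_tensorF linearP /= !flat_metricDr ?(vf_addE, vf_scaleE); ring.
Qed.

Lemma vfield_sum x : x = \sum_k x (X k) *: pd k.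
Proof. by apply: vfieldP => f; rewrite vf_sumE vfieldE. Qed.

Lemma conf_tensorF_sum x y z :
  F x y z = \sum_k \sum_l x (X k) * y (X l) * F (pd k) (pd l) z.
Proof.
have suml (a : 'I_(2 * n) -> Cinf M) (w : 'I_(2 * n) -> VF) (G : VF -> Cinf M) :
    (forall f x1 x2, G (f *: x1 + x2) = f * G x1 + G x2) ->
    G (\sum_k a k *: w k) = \sum_k a k * G (w k).
  move=> Glin; have G0 : G 0 = 0.
    have := Glin 1 0 0; rewrite scale1r mul1r addr0 => h.
    by apply: (addrI (G 0)); rewrite addr0 -h.
  elim/big_rec2: _ => [//|k v g _ <-]; exact: Glin.
rewrite {1}(vfield_sum x) (suml _ _ (fun x => F x y z)); last first.
  by move=> *; exact: conf_tensorF_linearl.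
apply: eq_bigr => k _.
rewrite {1}(vfield_sum y) (suml _ _ (fun y => F (pd k) y z)); last first.
  by move=> *; exact: conf_tensorF_linearr.
by rewrite mulr_sumr; apply: eq_bigr => l _; rewrite mulrA.
Qed.

Lemma flat_metric_dpartl k x : (sgn k)%:F * flat_metric (pd k) x = x (X k).
Proof. by rewrite flat_metricC flat_metric_dpart mulrA sgn2F mul1r. Qed.

(** The first two terms of F both sum to du(Jx) and cancel, the third vanishes since the k-th
    coordinate field is orthogonal to its image under J, and the last contributes du(Jx) for each of
    the 2n indices. *)
Lemma conf_tensorF_trace x :
  \sum_k (sgn k)%:F * F (pd k) (pd k) x = expf (u + u) * conf_theta x.
Proof.
have conj_neq k : (k == conj_ord k) = false.
  apply/negbTE/eqP => /(congr1 sgn); rewrite sgn_conj.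
  have := sgn2 k; rewrite /sgn; case: ifP => _ _ /eqP; rewrite ?opprK -subr_eq0 ?opprK.
    by rewrite (pnatr_eq0 _ 2).
  by rewrite -opprD oppr_eq0 (pnatr_eq0 _ 2).
have term k : (sgn k)%:F * F (pd k) (pd k) x = expf (u + u) *
    (x (X k) * stdJ (pd k) u - stdJ x (X k) * pd k u + stdJ x u).
  have dJ : flat_metric (pd k) (stdJ (pd k)) = 0.
    by rewrite flat_metricC flat_metric_dpart stdJ_coord dpart_coord conj_neq cfun0 !mulr0.
  have dd : flat_metric (pd k) (pd k) = (sgn k)%:F.
    by rewrite flat_metric_dpart dpart_coord eqxx cfun1 mulr1.
  rewrite conf_tensorF dJ dd mulr0 subr0.
  rewrite -(flat_metric_dpartl k x) -(flat_metric_dpartl k (stdJ x)).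
  transitivity (expf (u + u) * ((sgn k)%:F * flat_metric (pd k) x * stdJ (pd k) u -
    (sgn k)%:F * flat_metric (pd k) (stdJ x) * pd k u + (sgn k)%:F * (sgn k)%:F * stdJ x u)).
    by ring.
  by rewrite sgn2F mul1r.
under eq_bigr => k _ do rewrite term.
rewrite -mulr_sumr; congr (_ * _).
rewrite big_split sumrB -[X in _ - X](vfieldE (stdJ x) u).
have -> : \sum_k x (X k) * stdJ (pd k) u = stdJ x u.
  rewrite [in RHS](vfield_sum x) linear_sum vf_sumE.
  by apply: eq_bigr => k _; rewrite linearZ.
rewrite subrr [LHS]add0r sumr_const card_ord /conf_theta.
have cfun_nat q : (q%:R)%:F = q%:R :> Cinf M.
  by elim: q => [|q IH]; rewrite ?cfun0 // !mulrSr cfunD IH cfun1.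
by rewrite cfun_nat mulr_natl.
Qed.

(** Invariance of the trace under change of basis. If E holds the coordinates of the frame, the Gram
    matrix is E G E^T and F has matrix E Phi E^T, so the trace reduces to that of G^-1 Phi, computed
    in [conf_tensorF_trace]. *)
Lemma conf_lie_form : @lie_form R n conf_norden conf_conn conf_theta.
Proof.
move=> p e x fe.
pose E : 'M[R]_(2 * n) := \matrix_(i, k) e i (X k) p.
pose r := expf (u + u) p.
have r0 : r != 0 by rewrite gt_eqF ?expf_gt0.
pose G : 'M[R]_(2 * n) := diag_mx (\row_k (r * sgn k)).
pose Gi : 'M[R]_(2 * n) := diag_mx (\row_k (r^-1 * sgn k)).
pose Phi : 'M[R]_(2 * n) := \matrix_(k, l) F (pd k) (pd l) x p.
(* Expanding the coordinate fields in the frame yields the inverse A of E. *)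
have /choice[a aE] : forall k, exists a : 'rV[R]_(2 * n),
    forall f, pd k f p = \sum_i a 0 i * e i f p.
  by move=> k; have [a [ha _]] := fe (pd k); exists a.
pose A : 'M[R]_(2 * n) := \matrix_(k, i) a k 0 i.
have AE : A *m E = 1%:M.
  apply/matrixP => k l; rewrite !mxE; transitivity (pd k (X l) p).
    by rewrite aE; apply: eq_bigr => i _; rewrite !mxE.
  by rewrite dpart_coord.
have gramE : gram conf_metric e p = E *m G *m E^T.
  apply/matrixP => i j; rewrite [RHS]mxE [LHS]mxE Cinf_mulE Cinf_sumE mulr_sumr.
  apply: eq_bigr => k _; rewrite mul_mx_diag !mxE !Cinf_mulE -[_%:F p]/(sgn k) -/r; ring.
have GiG : Gi *m G = 1%:M.
  rewrite mulmx_diag; apply/matrixP => i j; rewrite !mxE; congr (_ *+ _).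
  by rewrite mulrACA mulVf // sgn2 mulr1.
pose K := A^T *m Gi *m A.
have KG : K *m gram conf_metric e p = 1%:M.
  rewrite gramE /K !mulmxA -(mulmxA _ A E) AE mulmx1 -(mulmxA _ Gi G) GiG mulmx1.
  by rewrite -trmx_mul (mulmx1C AE) trmx1.
have gramV : invmx (gram conf_metric e p) = K.
  by have [_ ug] := mulmx1_unit KG; rewrite -[LHS]mul1mx -KG mulmxK.
have FE i j : F (e i) (e j) x p = (E *m Phi *m E^T) i j.
  rewrite conf_tensorF_sum Cinf_sumE [RHS]mxE.
  under [RHS]eq_bigr => l _ do rewrite mxE mulr_suml.
  rewrite exchange_big; apply: eq_bigr => k _; rewrite Cinf_sumE.
  by apply: eq_bigr => l _; rewrite !mxE; move: (F _ _ _) => f; rewrite !Cinf_mulE; ring.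
(* The double sum of K_ij B_ij is the trace of K B^T. *)
transitivity (\tr (K *m (E *m Phi *m E^T)^T)).
  rewrite !trmx_mul trmxK /K !mulmxA -(mulmxA _ A E) AE mulmx1.
  rewrite mxtrace_mulC !mulmxA -trmx_mul AE trmx1 mul1mx mul_diag_mx.
  have h : \sum_k sgn k * F (pd k) (pd k) x p = r * conf_theta x p.
    have := congr1 (fun f : Cinf M => f p) (conf_tensorF_trace x).
    by rewrite Cinf_sumE.
  rewrite -[LHS](mulKf r0) -h mulr_sumr; apply: eq_bigr => k _.
  by rewrite !mxE mulrA.
rewrite /metric_trace /mxtrace; apply: eq_bigr => i _.
rewrite [LHS]mxE; apply: eq_bigr => j _.
by rewrite -[in LHS]gramV [X in _ * X]mxE -FE.
Qed.

Lemma conf_closed_star : closed_form (conf_theta \o stdJ).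
Proof.
move=> x y; rewrite /dform /= /conf_theta !stdJ2 !vf_oppE !vfZ !vfN /=; ring.
Qed.

Definition conf_form : oneform conf_norden := conf_theta.

Lemma conf_conformal_kahler : closed_form conf_theta ->
  @conformal_kahler R n conf_norden conf_conn conf_form conf_Omega.
Proof.
move=> cl; split.
- exact: levi_civita_conf.
- exact: conf_lie_form.
- exact: conf_thetaE.
- exact: conf_W1.
- exact: cl.
- exact: conf_closed_star.
Qed.

End Conformal.

(** * The example with u = Im(z_0^2)/2 *)

Fact ord_fst_subproof : (0 < 2 * n)%N. Proof. by lia. Qed.
Definition ord_fst : 'I_(2 * n) := Ordinal ord_fst_subproof.
Fact ord_scd_subproof : (1 < 2 * n)%N. Proof. by lia. Qed.
(** Since n > 1, this is the index of Re z_1, distinct from both indices of z_0. *)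
Definition ord_scd : 'I_(2 * n) := Ordinal ord_scd_subproof.

(* The function Im(z_0^2)/2. *)
Definition quad : Cinf M := X ord_fst * X (conj_ord ord_fst).

Lemma sgn_ord_fst : sgn ord_fst = 1. Proof. by rewrite /sgn /= ltnW. Qed.
Lemma sgn_ord_scd : sgn ord_scd = 1. Proof. by rewrite /sgn /= n1. Qed.
Lemma ord_scd_neq_fst : (ord_scd == ord_fst) = false. Proof. by []. Qed.
Lemma ord_scd_neq_conj_fst : (ord_scd == conj_ord ord_fst) = false.
Proof. by rewrite -val_eqE /= conj_ordE /=; case: ifP; lia. Qed.
Lemma ord_fst_neq_conj_fst : (ord_fst == conj_ord ord_fst) = false.
Proof. by rewrite -val_eqE /= conj_ordE /=; case: ifP; lia. Qed.

Lemma ord_fst_neq_conj_scd : (ord_fst == conj_ord ord_scd) = false.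
Proof. by rewrite -val_eqE /= conj_ordE /=; case: ifP; lia. Qed.
Lemma ord_scd_neq_conj_scd : (ord_scd == conj_ord ord_scd) = false.
Proof. by rewrite -val_eqE /= conj_ordE /=; case: ifP; lia. Qed.

(** Here theta = n d(Re z_0^2), an exact form vanishing at the origin. *)
Lemma conf_theta_quad x : conf_theta quad x =
  (2 * n)%:R%:F * (x (X ord_fst) * X ord_fst
    - x (X (conj_ord ord_fst)) * X (conj_ord ord_fst)).
Proof.
rewrite /conf_theta /quad vf_leibniz !stdJ_coord conj_ordK sgn_conj sgn_ord_fst.
rewrite !cfunN cfun1; ring.
Qed.

Lemma conf_theta_quad_closed : closed_form (conf_theta quad).
Proof.
move=> x y; rewrite /dform !conf_theta_quad !vfZ !vfB !vf_leibniz /=; ring.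
Qed.

Lemma conf_theta_quadJ x : conf_theta quad (stdJ x) =
  - ((2 * n)%:R%:F * (x (X ord_fst) * X (conj_ord ord_fst)
    + X ord_fst * x (X (conj_ord ord_fst)))).
Proof.
by rewrite /conf_theta stdJ2 vf_oppE /quad vf_leibniz mulrN.
Qed.

Lemma conf_theta_quad0 x : conf_theta quad x (0 : 'rV[R]_(2 * n)) = 0.
Proof.
rewrite conf_theta_quad.
rewrite -[LHS]/((2 * n)%:R
  * (_ * (0 : 'rV[R]_(2 * n)) 0 ord_fst - _ * (0 : 'rV[R]_(2 * n)) 0 _)).
by rewrite !mxE !mulr0 subr0 mulr0.
Qed.

(** As theta vanishes at the origin, nabla theta is there the ordinary Hessian of n Re(z_0^2),
    namely 2n Re(dz_0^2). *)
Lemma nabla1_quad x k :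
  nabla1 (conf_conn quad) (conf_theta quad) x (pd k) (0 : 'rV[R]_(2 * n)) =
  (2 * n)%:R * ((k == ord_fst)%:R * x (X ord_fst) 0
    - (k == conj_ord ord_fst)%:R * x (X (conj_ord ord_fst)) 0).
Proof.
rewrite /nabla1 Cinf_addE Cinf_oppE conf_theta_quad0 subr0.
rewrite conf_theta_quad !dpart_coord vfZ vfB !vfZ.
by [].
Qed.

Lemma nabla1_quadJ x k :
  nabla1 (conf_conn quad) (conf_theta quad) x (stdJ (pd k)) (0 : 'rV[R]_(2 * n)) =
  - ((2 * n)%:R * ((k == ord_fst)%:R * x (X (conj_ord ord_fst)) 0
    + (k == conj_ord ord_fst)%:R * x (X ord_fst) 0)).
Proof.
rewrite /nabla1 Cinf_addE Cinf_oppE conf_theta_quad0 subr0.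
rewrite conf_theta_quadJ !dpart_coord (mulrC (X ord_fst)) vfN vfZ vfD !vfZ.
by [].
Qed.

Lemma metric_quad x k : conf_metric quad x (pd k) 0 = sgn k * x (X k) 0.
Proof.
rewrite /conf_metric flat_metric_dpart -[LHS]/(expR _ * (sgn k * _)).
have q0 : quad 0 = 0.
  by rewrite -[LHS]/((0 : 'rV[R]_(2 * n)) 0 ord_fst * _) mxE mul0r.
by rewrite -[X in expR X]/(quad 0 + quad 0) q0 addr0 expR0 mul1r.
Qed.

Lemma metric_quadJ x k : conf_metric quad x (stdJ (pd k)) 0 = - x (X (conj_ord k)) 0.
Proof.
rewrite /conf_metric -flat_metricJl -[LHS]/(conf_metric quad (stdJ x) (pd k) 0).
rewrite metric_quad stdJ_coord -[X in sgn k * X]/(- sgn k * x (X (conj_ord k)) 0).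
by rewrite mulrA mulrN sgn2 mulN1r.
Qed.

Lemma dpart_coord0 i j : pd i (X j) (0 : 'rV[R]_(2 * n)) = (i == j)%:R.
Proof. by rewrite dpart_coord. Qed.

(** Antisymmetry makes the defect vanish at the origin. Take z = d/dx_0 and y = u = d/dx_1, where
    z_j = x_j + i y_j: nabla theta ignores z_1, and g(y,u) = 1 is the only metric factor left, so
    that (lambda_5 + lambda_7) N(x,z) + (lambda_6 + lambda_8) N(x,Jz) = 0. *)
Lemma kahler_quad l1 l2 l3 l4 l5 l6 l7 l8 :
  @kahler_tensor R n (conf_norden quad) (curvature4 (@nm_g R n (conf_norden quad))
    (@nabla' R n (conf_norden quad) l1 l2 l3 l4 l5 l6 l7 l8
      (conf_conn quad) (conf_form quad) (conf_Omega quad))) ->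
  l7 = - l5 /\ l8 = - l6.
Proof.
move=> [[_ anti _] _].
have hn : (0 < n)%N by lia.
have n0 : (n%:R : R) != 0 by rewrite pnatr_eq0 -lt0n.
have ck := conf_conformal_kahler conf_theta_quad_closed.
pose N x y := nabla1 (conf_conn quad) (conf_theta quad) x y 0.
pose G x y := conf_metric quad x y 0.
have defect x : let y := pd ord_scd in let z := pd ord_fst in let u := pd ord_scd in
  0 = (n%:R^-1) *
   ((l5 + l7) * (N x z * G y u + N x u * G y z
       - N x (stdJ z) * G y (stdJ u) - N x (stdJ u) * G y (stdJ z)
     - (N y z * G x u + N y u * G x z
       - N y (stdJ z) * G x (stdJ u) - N y (stdJ u) * G x (stdJ z)))
   + (l6 + l8) * (N x z * G y (stdJ u) + N x (stdJ z) * G y u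
       + N x u * G y (stdJ z) + N x (stdJ u) * G y z
     - (N y z * G x (stdJ u) + N y (stdJ z) * G x u
       + N y u * G x (stdJ z) + N y (stdJ u) * G x z))).
  have := curvature_defect hn ck conf_theta_quad0 l1 l2 l3 l4 l5 l6 l7 l8
    x (pd ord_scd) (pd ord_fst) (pd ord_scd).
  by cbv zeta; rewrite (anti x (pd ord_scd) (pd ord_fst)) Cinf_oppE addNr.
have neq := (ord_scd_neq_fst, ord_scd_neq_conj_fst, ord_fst_neq_conj_fst,
  ord_fst_neq_conj_scd, ord_scd_neq_conj_scd,
  eq_sym ord_fst ord_scd, eq_sym (conj_ord ord_fst), inj_eq (inv_inj conj_ordK), eqxx).
have cancel (t : R) : 0 = n%:R^-1 * (t * (2 * n)%:R) -> t = 0.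
  have nn : ((2 * n)%:R : R) != 0 by rewrite pnatr_eq0; lia.
  by move=> /esym/eqP; rewrite !mulf_eq0 invr_eq0 (negbTE n0) (negbTE nn) orbF => /eqP.
split.
(* For x = d/dx_0, N(x,z) = 2n and N(x,Jz) = 0. *)
- have := defect (pd ord_fst); rewrite /N /G.
  rewrite !(nabla1_quad, nabla1_quadJ) !(metric_quad, metric_quadJ).
  rewrite !dpart_coord0 !neq sgn_ord_fst sgn_ord_scd /= => h.
  have /cancel : 0 = n%:R^-1 * ((l5 + l7) * (2 * n)%:R) by rewrite [LHS]h; ring.
  by lra.
(* For x = d/dy_0, N(x,z) = 0 and N(x,Jz) = -2n. *)
- have := defect (pd (conj_ord ord_fst)); rewrite /N /G.
  rewrite !(nabla1_quad, nabla1_quadJ) !(metric_quad, metric_quadJ).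
  rewrite !dpart_coord0 !neq sgn_ord_fst sgn_ord_scd /= => h.
  have /cancel : 0 = n%:R^-1 * (- (l6 + l8) * (2 * n)%:R) by rewrite [LHS]h; ring.
  by lra.
Qed.

End Example.

Theorem theorem3p4 (R : realType) (n : nat) (hn : (0 < n)%N)
    (l1 l2 l3 l4 l5 l6 l7 l8 : R) :
  [/\ (forall (M : norden_manifold R n)
          (D : vfield M -> vfield M -> vfield M) (theta : oneform M)
          (Omega : vfield M),
        conformal_kahler D theta Omega ->
        complex_connection (nabla' l1 l2 l3 l4 l5 l6 l7 l8 D theta Omega)),
      ((1 < n)%N ->
        ((forall (M : norden_manifold R n)
            (D : vfield M -> vfield M -> vfield M) (theta : oneform M)
            (Omega : vfield M),
          conformal_kahler D theta Omega ->
          kahler_tensor (curvature4 (@nm_g R n M)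
            (nabla' l1 l2 l3 l4 l5 l6 l7 l8 D theta Omega)))
        <-> (l7 = - l5 /\ l8 = - l6)))
    & (l7 = - l5 -> l8 = - l6 ->
        forall (M : norden_manifold R n)
          (D : vfield M -> vfield M -> vfield M) (theta : oneform M)
          (Omega : vfield M),
        conformal_kahler D theta Omega ->
        let g := @nm_g R n M in
        let J := nm_J M in
        let R' := curvature4 g
          (nabla' l1 l2 l3 l4 l5 l6 l7 l8 D theta Omega) in
        let R0 := curvature4 g (nabla0 D theta Omega) in
        let S1 := tensorS1 l7 D theta Omega in
        let S2 := tensorS2 l8 D theta Omega in
        let S3 := tensorS3 theta in
        let P := tensorP D theta Omega in
        [/\ kahler_tensor R',
            (forall x y z u,
              R' x y z u = R0 x y z u
                + (l7 / n%:R)%:F * psi12 S1 x y z u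
                + (l8 / n%:R)%:F * psi12 S2 x y z u
                + (l7 * (4 * l8 - 1) / (2 * n%:R ^+ 2))%:F * psi12 S3 x y z u
                + (l7 * (1 - 2 * l8) / n%:R ^+ 2)%:F * theta (J Omega)
                    * (pi1 x y z u - pi2 x y z u)
                + (2 * l7 * l8 / n%:R ^+ 2)%:F * theta Omega * pi3 x y z u)
          & (forall x y z u,
              R0 x y z u =
              curvature4 g D x y z u
                - ((2 * n)%:R^-1)%:F * psi1 P x y z u)])].
Proof.
(* The formulas are stated with lambda_7 and lambda_8 free, so the relations are solved for lambda_5
   and lambda_6. *)
have hl : l7 = - l5 -> l8 = - l6 -> l5 = - l7 /\ l6 = - l8.
  by move=> -> ->; rewrite !opprK.
split.
- by move=> M D theta Omega ck; exact: complex_connection_nabla'.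
(* A manifold with theta = 0 puts no condition on the parameters, so necessity is tested on the
   conformally flat example. *)
- move=> n1; split=> [kahler|[/hl/[apply] -[-> ->]] M D theta Omega ck].
    have ck := conf_conformal_kahler n1 (@conf_theta_quad_closed R n n1).
    exact: (@kahler_quad R n n1 l1 l2 l3 l4 l5 l6 l7 l8 (kahler _ _ _ _ ck)).
  exact: kahler_nabla'.
move=> /hl/[apply] -[e5 e6] M D theta Omega ck g J R' R0 S1 S2 S3 P.
split.
- by rewrite /R' e5 e6; exact: kahler_nabla'.
- move=> x y z u; rewrite /R' /R0 e5 e6 (curvature4_nabla' hn ck) (nabla0E D theta Omega).
  exact: curvature_diff_formula.
- by move=> x y z u; exact: curvature_nabla0_formula.
Qed.
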